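(* Let $m\in\mathbb{N}$ be squarefree, $K=\mathbb{Q}(\sqrt{-m})\subset\mathbb{C}$ with ring of integers $\mathcal{O}_K$, $\Gamma_K=SL_2(\mathcal{O}_K)$, and let $\Gamma_K^*$ be the maximal discrete extension of $\Gamma_K$ in $SL_2(\mathbb{C})$ (the unique maximal discrete subgroup of $SL_2(\mathbb{C})$ containing $\Gamma_K$). Let $V=\{H\in\mathbb{C}^{2\times 2};\ H=\overline{H}^{tr}\}$ with quadratic form $q(H)=\det H$, $SO_0(V,q)=\{\varphi\in SO(V,q);\ \operatorname{trace}\varphi(E)>0\}$ ($E$ the identity matrix), and $\phi:SL_2(\mathbb{C})\to SO_0(V,q)$, $M\mapsto\phi_M$, $\phi_M(H)=MH\overline{M}^{tr}$. Let $\Lambda_K=V\cap\mathcal{O}_K^{2\times 2}$ and \[ \Sigma_K^*=\{\varphi\in SO_0(V,q);\ \varphi(\Lambda_K)=\Lambda_K\}. \] Then $\phi(\Gamma_K^* )=\Sigma_K^*$.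
   Context: $SO(V,q)$ is the special orthogonal group of the real quadratic space $(V,q)$, of signature $(1,3)$; $SO_0(V,q)$ is its identity component. *)

(* Defs.v *)
From HB Require Import structures.
From mathcomp Require Import all_boot all_order all_algebra complex.
From mathcomp Require Import all_classical all_reals all_analysis.

Set Implicit Arguments.
Unset Strict Implicit.
Unset Printing Implicit Defensive.
Import Order.TTheory GRing.Theory Num.Theory.
Import numFieldNormedType.Exports.
Local Open Scope classical_set_scope.
Local Open Scope ring_scope.
Local Open Scope complex_scope.
Local Open Scope sesquilinear_scope.

Definition squarefree (m : nat) : Prop :=
  forall d : nat, (d ^ 2 %| m)%N -> d = 1%N.

Section DiscreteExtensions.
Variable C : numFieldType.
Implicit Types G : set 'M[C]_2.

Definition SL2 : set 'M[C]_2 := [set M | \det M = 1].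

Definition SL2_subgroup G : Prop :=
  [/\ G `<=` SL2, G 1%:M,
      forall M N, G M -> G N -> G (M *m N)
    & forall M, G M -> G (invmx M)].

Definition discrete_set G : Prop := G `<=` isolated G.

Definition discrete_extension (G0 G : set 'M[C]_2) : Prop :=
  [/\ SL2_subgroup G, G0 `<=` G & discrete_set G].

Definition maximal_discrete_extension (G0 G : set 'M[C]_2) : Prop :=
  discrete_extension G0 G /\
  forall G', discrete_extension G0 G' -> G `<=` G' -> G' = G.

End DiscreteExtensions.

Section ImaginaryQuadratic.
Variable C : numClosedFieldType.
Variable m : nat.

(* The field Q(sqrt(-m)): the smallest subfield of C containing sqrt(-m). *)
Definition imquad : set C :=
  [set z | forall S : {pred C},
     divring_closed S -> sqrtC (- m%:R) \in S -> z \in S].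

Definition imquad_int : set C :=
  [set z | imquad z /\ integralOver (intr : int -> C) z].

Definition GammaK : set 'M[C]_2 :=
  [set M | SL2 M /\ forall i j, imquad_int (M i j)].

End ImaginaryQuadratic.

(* Independent of the basis, vbasis {:V} being just some basis of V. *)
Definition endo_det (F : fieldType) (V : vectType F) (f : 'End(V)) : F :=
  \det (passmx.mxof (vbasis {:V}) (vbasis {:V}) f).

Section HermitianSpace.
Variable R : realType.
Local Notation C := R[i].

Definition hermitian2 : {pred 'M[C]_2} := fun H => H == H ^t*.

Lemma hermitian2P (H : 'M[C]_2) : reflect (H = H ^t*) (H \in hermitian2).
Proof. exact: eqP. Qed.

Lemma hermitian2_zmod_closed : zmod_closed hermitian2.
Proof.
split=> [|A B /hermitian2P hA /hermitian2P hB]; apply/hermitian2P.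
  by apply/matrixP=> i j; rewrite !mxE rmorph0.
by rewrite {1}hA {1}hB; apply/matrixP=> i j; rewrite !mxE rmorphB.
Qed.

HB.instance Definition _ :=
  GRing.isZmodClosed.Build 'M[C]_2 hermitian2 hermitian2_zmod_closed.

Record herm := Herm { herm_mx :> 'M[C]_2; _ : herm_mx \in hermitian2 }.

HB.instance Definition _ := [isSub for herm_mx].
HB.instance Definition _ := [Choice of herm by <:].
HB.instance Definition _ := [SubChoice_isSubZmodule of herm by <:].

Lemma hermP (H : herm) : (H : 'M[C]_2) = H ^t*.
Proof. by apply/hermitian2P; case: H. Qed.

Lemma herm_scale_subproof (a : R) (H : herm) :
  a%:C *: (H : 'M[C]_2) \in hermitian2.
Proof.
apply/hermitian2P; rewrite {1}(hermP H); apply/matrixP=> i j.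
by rewrite !mxE rmorphM; congr (_ * _); rewrite [RHS]conjc_real.
Qed.

Definition herm_scale (a : R) (H : herm) : herm := Herm (herm_scale_subproof a H).

Lemma herm_scaleA a b H : herm_scale a (herm_scale b H) = herm_scale (a * b) H.
Proof. by apply/val_inj; rewrite /= scalerA rmorphM. Qed.

Lemma herm_scale1 : left_id 1 herm_scale.
Proof. by move=> H; apply/val_inj; rewrite /= scale1r. Qed.

Lemma herm_scaleDr : right_distributive herm_scale +%R.
Proof. by move=> a G H; apply/val_inj; rewrite /= scalerDr. Qed.

Lemma herm_scaleDl H : {morph herm_scale^~ H : a b / a + b}.
Proof. by move=> a b; apply/val_inj; rewrite /= rmorphD scalerDl. Qed.

HB.instance Definition _ := GRing.Zmodule_isLmodule.Build R herm
  herm_scaleA herm_scale1 herm_scaleDr herm_scaleDl.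

Definition herm_coord (H : herm) : 'rV[R]_4 :=
  \row_i [:: complex.Re (H 0 0); complex.Re (H 1 1);
             complex.Re (H 0 1); complex.Im (H 0 1)]`_i.

Definition herm_of_coord_mx (v : 'rV[R]_4) : 'M[C]_2 :=
  \matrix_(i, j)
    if i == j then (v 0 (inord i))%:C
    else if i == 0 then v 0 (inord 2) +i* v 0 (inord 3)
    else v 0 (inord 2) -i* v 0 (inord 3).

Lemma herm_of_coord_subproof v : herm_of_coord_mx v \in hermitian2.
Proof.
apply/hermitian2P/matrixP=> i j; rewrite !mxE eq_sym.
case: eqVneq => [->|]; first by rewrite [RHS]conjc_real.
by case: i j => [[|[]]] // ? [[|[]]] // ? _; rewrite -[RHS]/(conjc _) /= ?opprK.
Qed.

Lemma herm_coord_is_linear : linear herm_coord.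
Proof.
move=> a G H; apply/rowP=> k; rewrite !mxE /=.
by case: k => [[|[|[|[|]]]]] //= ?;
  case: (herm_mx G _ _) => x y; case: (herm_mx H _ _) => z t /=;
  rewrite ?mul0r ?addr0 ?subr0.
Qed.

Lemma ord2E (i : 'I_2) : i = 0 \/ i = 1.
Proof. by case: i => [[|[|]]] // ?; [left|right]; apply/val_inj. Qed.

Lemma herm_coord_bij : bijective herm_coord.
Proof.
exists (fun v => Herm (herm_of_coord_subproof v)) => [H|v].
  have hE i j : (H : 'M[C]_2) i j = (H j i)^*%C.
    by rewrite {1}(hermP H) !mxE.
  have hd i : (complex.Re (H i i))%:C = H i i.
    have := hE i i; case: (H i i) => x y /= [] /eqP.
    by rewrite -subr_eq0 opprK -mulr2n mulrn_eq0 /= => /eqP ->.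
  apply/val_inj/matrixP=> i j /=; rewrite !mxE.
  case: (ord2E i) => ->; case: (ord2E j) => -> /=; rewrite ?inordK //= ?hd //.
    by case: (H 0 1).
  by rewrite (hE 1 0); case: (H 0 1).
apply/rowP=> k; rewrite !mxE.
by case: k => [[|[|[|[|]]]]] //= ?; congr (v _ _); apply/val_inj; rewrite /= inordK.
Qed.

HB.instance Definition _ := Lmodule_hasFinDim.Build R herm
  (exist2 _ _ herm_coord herm_coord_is_linear herm_coord_bij).

(* det H is real for hermitian H, see herm_qE. *)
Definition herm_q (H : herm) : R := complex.Re (\det (H : 'M[C]_2)).

Lemma herm_qE (H : herm) : (herm_q H)%:C = \det (H : 'M[C]_2).
Proof.
rewrite /herm_q; have : \det (H : 'M[C]_2) = (\det (H : 'M[C]_2))^*%C.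
  rewrite {1}(hermP H) -[RHS]/(Num.conj _) -det_map_mx -det_tr.
  by congr (\det _); apply/matrixP=> i j; rewrite !mxE.
case: (\det _) => x y /= [] /eqP.
by rewrite -subr_eq0 opprK -mulr2n mulrn_eq0 /= => /eqP ->.
Qed.

Lemma herm1_subproof : 1%:M \in hermitian2.
Proof. by apply/hermitian2P/matrixP=> i j; rewrite !mxE eq_sym rmorph_nat. Qed.

Definition herm1 : herm := Herm herm1_subproof.

Definition SO_herm : set 'End(herm) :=
  [set f : 'End(herm) | (forall H, herm_q (f H) = herm_q H) /\ endo_det f = 1].

Definition SO0_herm : set 'End(herm) :=
  [set f : 'End(herm) | SO_herm f /\ 0 < \tr (f herm1 : 'M[C]_2)].

Lemma phi_subproof (M : 'M[C]_2) (H : herm) :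
  M *m H *m M ^t* \in hermitian2.
Proof.
apply/hermitian2P; rewrite {1}(hermP H).
rewrite !trmx_mul !map_mxM mulmxA.
congr (_ *m _ *m _); apply/matrixP=> i j; rewrite !mxE //.
by rewrite -[RHS]/(conjc (conjc _)) conjcK.
Qed.

Definition phi_fun (M : 'M[C]_2) (H : herm) : herm := Herm (phi_subproof M H).

Lemma phi_fun_is_linear M : linear (phi_fun M).
Proof.
move=> a G H; apply/val_inj.
by rewrite /= mulmxDr mulmxDl -scalemxAr -scalemxAl.
Qed.

HB.instance Definition _ M :=
  GRing.isLinear.Build R herm herm _ (phi_fun M) (phi_fun_is_linear M).

Definition phi (M : 'M[C]_2) : 'End(herm) := linfun (phi_fun M).

Lemma phiE M H : herm_mx (phi M H) = M *m H *m M ^t*.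
Proof. by rewrite lfunE. Qed.

Variable m : nat.

Definition LambdaK : set herm :=
  [set H | forall i j, imquad_int m ((H : 'M[C]_2) i j)].

Definition SigmaStar : set 'End(herm) :=
  [set f : 'End(herm) | SO0_herm f /\ f @` LambdaK = LambdaK].

End HermitianSpace.

(* Main.v *)
Require Import Defs.
From HB Require Import structures.
From mathcomp Require Import all_boot all_order all_algebra complex.
From mathcomp Require Import all_classical all_reals all_analysis.
From mathcomp Require Import ring lra.
Local Open Scope classical_set_scope.
Local Open Scope ring_scope.
Local Open Scope complex_scope.
Local Open Scope sesquilinear_scope.

Set Implicit Arguments.
Unset Strict Implicit.
Unset Printing Implicit Defensive.
Import Order.TTheory GRing.Theory Num.Theory.
Import numFieldNormedType.Exports.

(**
Let G be a discrete subgroup of SL_2(C) containing SL_2(O_K). For w = M v with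
M in G and v in O_K^2, the unipotent 1 + w (Jw)^T is conjugate under M to an
element of SL_2(O_K), so it lies in G and cannot be close to 1: the second
coordinate of w is 0 or bounded away from 0. Dirichlet's approximation theorem
over O_K then shows that every M in G is a multiple l N of a matrix N over K,
with l^2 in K. For the elements g of G with entries in K, two short vectors in
g O_K^2 (again from Dirichlet) together with the finiteness of bounded parts of
G give a common denominator for all lower left entries c(g); since
c(g) c(h) = c(g T h) - c(g h), with T the translation by 1, the powers of c(g)
have bounded denominators, and c(g) is integral. Applied to M T M^-1 this gives
that the squares of the entries of M are in O_K. Together with det M = 1 this
forces the products x y^* of entries to be in O_K, so phi_M preserves Lambda_K.

Hence every discrete extension of SL_2(O_K) lies in the stabilizer of Lambda_K,
which is itself a discrete extension, and the maximal one is this stabilizer.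
It remains to see that phi maps SL_2(C) onto SO_0(V, q): multiplying by suitable
phi_M one reduces to an isometry fixing the identity matrix and the first two
of the three Pauli matrices, for which the determinant decides the sign on the
third.
*)

(** * Integrality criteria for rational numbers *)

(** Gauss's lemma: the factor ['X - u] of a monic integer polynomial is proportional to an integer
    factor [p1], whose leading coefficient divides 1 and so is a sign. *)
Lemma rat_integral_int (F : numFieldType) (u : rat) :
  integralOver (intr : int -> F) (ratr u) -> exists k : int, u = k%:~R.
Proof.
case=> p p_mon; rewrite -[map_poly _ p](_ : map_poly ratr (map_poly intr p) = _); last first.
  by rewrite -map_poly_comp; apply: eq_map_poly => k /=; rewrite ratr_int.
rewrite fmorph_root root_factor_theorem => /dvdpP_rat_int[p1 [a a0 pE] [r rE]].
have p1u : lead_coef p1 \is a GRing.unit.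
  have : lead_coef p1 * lead_coef r = 1 by rewrite -lead_coefM -rE; apply/eqP.
  by move=> h; apply/unitrPr; exists (lead_coef r).
have sp1 : size p1 = 2.
  have := congr1 (fun q : {poly rat} => size q) pE.
  by rewrite size_XsubC size_scale // size_map_poly_id0 // intr_eq0 lead_coef_eq0;
    apply: contraTneq p1u => ->; rewrite lead_coef0 unitr0.
have aE : 1 = a * (p1`_1)%:~R.
  have := congr1 (fun q : {poly rat} => q`_1) pE.
  by rewrite coefB coefX coefC coefZ coef_map /= subr0.
have uE : - u = a * (p1`_0)%:~R.
  have := congr1 (fun q : {poly rat} => q`_0) pE.
  by rewrite coefB coefX coefC coefZ coef_map /= sub0r.
move: p1u; rewrite lead_coefE sp1 /= => /orP h.
have {h} h : (p1`_1 == 1) || (p1`_1 == -1).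
  by case: h => /eqP ->; rewrite ?eqxx ?orbT.
case/orP: h aE => /eqP -> aE.
  by exists (- p1`_0); rewrite mulrNz -[u]opprK uE -[a]mulr1 -aE mul1r.
exists (p1`_0); rewrite -[u]opprK uE; move: aE; rewrite mulrNz mulrN1 => aE.
by have -> : a = -1 by [rewrite aE opprK]; rewrite mulN1r opprK.
Qed.

(** Every power of [denq u] divides the fixed nonzero integer [numq D]. *)
Lemma rat_bounded_denominator_int (D u : rat) :
  D != 0 -> (forall n, exists k : int, D * u ^+ n = k%:~R) ->
  exists k : int, u = k%:~R.
Proof.
move=> D0 Dk; exists (numq u).
suff d1 : denq u = 1 by rewrite -{1}[u]divq_num_den d1 divr1.
have dvd n : (denq u ^+ n %| numq D)%Z.
  have [k kE] := Dk n.
  have cop : coprimez (denq u ^+ n) (numq u ^+ n).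
    by rewrite coprimezXl // coprimezXr // /coprimez gcdzC; exact: coprime_num_den.
  rewrite -(Gauss_dvdzl _ cop); apply/dvdzP; exists (denq D * k).
  apply: (@intr_inj rat); rewrite !rmorphM /= !rmorphXn /= -kE.
  by rewrite !numqE exprMn; ring.
have nD0 : `|numq D|%N != 0%N by rewrite absz_eq0 numq_eq0.
(* The exponent [|numq D|] is already too large for a base of at least 2, since [n < d ^ n]. *)
have : (`|denq u| ^ `|numq D| <= `|numq D|)%N.
  rewrite -abszX; apply: dvdn_leq; first by rewrite lt0n.
  exact: dvd.
have d0 := denq_gt0 u; move: d0 nD0; rewrite -lt0n.
case: (denq u) => // d; rewrite ltz_nat absz_nat => d0 nD0.
have [d2|d2] := ltnP 1 d; last by move=> _; congr Posz; apply/eqP; rewrite eqn_leq d0 d2.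
by rewrite leqNgt ltn_expl.
Qed.

(** * The field [K] in rational coordinates, and complex conjugation on it *)

Section QuadraticField.
Variables (R : realType) (m : nat).
Hypothesis m_gt0 : (0 < m)%N.
Local Notation C := R[i].
Local Notation K := (@imquad C m).

Definition sqrtNm : C := sqrtC (- m%:R).
Local Notation w := sqrtNm.

Lemma sqrtNm_sqr : w ^+ 2 = - m%:R.
Proof. exact: sqrtCK. Qed.

(** Whichever root [sqrtC] picks, its conjugate is [w] or [- w]; the first would make [w ^+ 2 = - m]
    a nonnegative number. *)
Lemma sqrtNm_conj : w^*%C = - w.
Proof.
have : (w^*%C) ^+ 2 == w ^+ 2.
  by rewrite -rmorphXn /= sqrtNm_sqr rmorphN /= rmorph_nat.
rewrite eqf_sqr => /orP[/eqP h|/eqP //].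
have : 0 <= w * w^*%C by exact: mulcJ_ge0.
by rewrite h -expr2 sqrtNm_sqr oppr_ge0 lern0 => /eqP m0; move: m_gt0; rewrite m0.
Qed.

Lemma sqrtNm_neq0 : w != 0.
Proof. by rewrite -sqrf_eq0 sqrtNm_sqr oppr_eq0 pnatr_eq0 -lt0n. Qed.

Lemma imquadB x y : K x -> K y -> K (x - y).
Proof. by move=> Kx Ky S cS wS; case: (cS) => _ h _; apply: h; [exact: Kx|exact: Ky]. Qed.

Lemma imquad_div x y : K x -> K y -> K (x / y).
Proof. by move=> Kx Ky S cS wS; case: (cS) => _ _ h; apply: h; [exact: Kx|exact: Ky]. Qed.

Lemma imquad1 : K 1.
Proof. by move=> S [? _ _] _. Qed.

Lemma imquad0 : K 0.
Proof. by rewrite -(subrr 1); apply: imquadB; exact: imquad1. Qed.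

Lemma imquadN x : K x -> K (- x).
Proof. by move=> Kx; rewrite -sub0r; apply: imquadB => //; exact: imquad0. Qed.

Lemma imquadD x y : K x -> K y -> K (x + y).
Proof. by move=> Kx Ky; rewrite -[y]opprK; apply/imquadB/imquadN. Qed.

Lemma imquadV x : K x -> K x^-1.
Proof. by move=> Kx; rewrite -div1r; apply: imquad_div => //; exact: imquad1. Qed.

Lemma imquadM x y : K x -> K y -> K (x * y).
Proof. by move=> Kx Ky; rewrite -[y]invrK; apply/imquad_div/imquadV. Qed.

Lemma imquadX x n : K x -> K (x ^+ n).
Proof.
by move=> Kx; elim: n => [|n IH]; rewrite ?expr0 ?exprS; [exact: imquad1|exact: imquadM].
Qed.

Lemma imquad_int_cst (k : int) : K k%:~R.
Proof.
have Kn n : K n%:R.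
  by elim: n => [|n IH]; [exact: imquad0|rewrite mulrS; apply/imquadD/IH/imquad1].
by case: k => n; [exact: Kn|rewrite NegzE mulrNz; exact/imquadN/Kn].
Qed.

Lemma imquad_rat (u : rat) : K (ratr u).
Proof. by rewrite /ratr; apply/imquad_div; exact: imquad_int_cst. Qed.

Lemma imquad_sqrt : K w.
Proof. by move=> S _. Qed.

(** The numbers of this form are closed under subtraction and division and include [w], so they
    contain the smallest such set. *)
Lemma imquadP z : K z -> exists x y : rat, z = ratr x + ratr y * w.
Proof.
pose S := [pred z : C | `[< exists x y : rat, z = ratr x + ratr y * w >]].
move=> Kz; suff : z \in S by move=> h; apply/asboolP; exact: h.
apply: Kz; last first.
  by apply/asboolP; exists 0, 1; rewrite !rmorph0 !rmorph1 add0r mul1r.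
split=> [|a b|a b].
- by apply/asboolP; exists 1, 0; rewrite !rmorph0 !rmorph1 mul0r addr0.
- move=> /asboolP[x [y ->]] /asboolP[x' [y' ->]]; apply/asboolP.
  by exists (x - x'), (y - y'); rewrite !rmorphB /=; ring.
- move=> /asboolP[x [y ->]] /asboolP[x' [y' ->]]; apply/asboolP.
  have mE : m%:R = - w ^+ 2 by rewrite sqrtNm_sqr opprK.
  move: sqrtNm mE => v mE.
  pose n : rat := x' ^+ 2 + m%:R * y' ^+ 2.
  exists ((x * x' + m%:R * y * y') / n), ((y * x' - x * y') / n).
  (* The norm [n] vanishes only for the divisor 0; division by 0 then returns 0, and so do the two
     witnesses. *)
  have [n0|n0] := eqVneq n 0.
    rewrite n0 invr0 !mulr0 !rmorph0 mul0r addr0.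
    move/eqP: n0; rewrite /n paddr_eq0 ?sqr_ge0 ?(mulr_ge0 (ler0n _ _) (sqr_ge0 _)) //.
    rewrite sqrf_eq0 mulf_eq0 sqrf_eq0 pnatr_eq0 eqn0Ngt m_gt0 /=.
    move=> /andP[/eqP -> /eqP ->].
    by rewrite !rmorph0 mul0r addr0 invr0 mulr0.
  have N0 : ratr n = (ratr x' + ratr y' * v) * (ratr x' - ratr y' * v).
    rewrite /n rmorphD rmorphXn rmorphM rmorphXn /= ratr_nat.
    by rewrite mE; ring.
  have Nn0 : ratr n != 0 :> C by rewrite fmorph_eq0; exact: n0.
  have : (ratr x' + ratr y' * v) * (ratr x' - ratr y' * v) != 0 by rewrite -N0.
  rewrite mulf_eq0 negb_or => /andP[d0 d1].
  rewrite !fmorph_div /= N0 !rmorphB !rmorphD /= !rmorphM /= !ratr_nat.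
  by rewrite mE; field; rewrite d0 d1.
Qed.

Lemma ratr_conj (u : rat) : (ratr u : C)^*%C = ratr u.
Proof. exact: fmorph_rat. Qed.

Lemma conj_quad (x y : rat) : (ratr x + ratr y * w)^*%C = ratr x - ratr y * w.
Proof. by rewrite rmorphD /= ratr_conj rmorphM /= ratr_conj sqrtNm_conj mulrN. Qed.

Lemma imquad_conj z : K z -> K z^*%C.
Proof.
move=> /imquadP[x [y ->]]; rewrite conj_quad.
by apply: imquadB; [exact: imquad_rat|apply/imquadM/imquad_sqrt; exact: imquad_rat].
Qed.

Lemma imquad_real z : K z -> z^*%C = z -> exists u : rat, z = ratr u.
Proof.
move=> /imquadP[x [y ->]]; rewrite conj_quad.
move=> /addrI /eqP; rewrite -subr_eq0 -opprD oppr_eq0 -mulr2n mulrn_eq0 /=.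
by rewrite mulf_eq0 (negPf sqrtNm_neq0) orbF => /eqP ->; exists x; rewrite mul0r addr0.
Qed.

Lemma imquad_trace z : K z -> exists u : rat, z + z^*%C = ratr u.
Proof.
move=> Kz; apply: imquad_real; first exact/imquadD/imquad_conj.
by rewrite rmorphD /= conjcK addrC.
Qed.

Lemma imquad_norm z : K z -> exists u : rat, z * z^*%C = ratr u.
Proof.
move=> Kz; apply: imquad_real; first exact/imquadM/imquad_conj.
by rewrite rmorphM /= conjcK mulrC.
Qed.

End QuadraticField.

(** * The modulus on [C] with values in [R] *)

Section ComplexModulus.
Variable R : realType.
Local Notation C := R[i].
Local Notation nm := (@Normc.normc R).
Implicit Types z : C.

Lemma nmE z : (nm z)%:C = `|z|.
Proof. by []. Qed.

Lemma nm_ge0 z : 0 <= nm z.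
Proof. by rewrite -ler0c nmE. Qed.

Lemma nm_eq0 z : (nm z == 0) = (z == 0).
Proof. by rewrite -[RHS]normr_eq0 -nmE -(inj_eq (@complexI R)). Qed.

Lemma nm_gt0 z : (0 < nm z) = (z != 0).
Proof. by rewrite lt_def nm_ge0 andbT nm_eq0. Qed.

Lemma nmM z z' : nm (z * z') = nm z * nm z'.
Proof. exact: Normc.normcM. Qed.

Lemma nmX z n : nm (z ^+ n) = nm z ^+ n.
Proof. by elim: n => [|n IH]; rewrite ?expr0 ?Normc.normc1 // !exprS nmM IH. Qed.

Lemma nmV z : nm z^-1 = (nm z)^-1.
Proof. exact: Normc.normcV. Qed.

Lemma nmN z : nm (- z) = nm z.
Proof. exact: normcN. Qed.

Lemma nmD z z' : nm (z + z') <= nm z + nm z'.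
Proof. exact: le_normcD. Qed.

Lemma nmB z z' : nm (z - z') <= nm z + nm z'.
Proof. by rewrite -(nmN z'); exact: nmD. Qed.

Lemma nmR (x : R) : nm x%:C = `|x|.
Proof. by rewrite /= expr0n addr0 sqrtr_sqr. Qed.

Lemma nmJ z : nm z^*%C = nm z.
Proof. by apply: (@complexI R); rewrite !nmE normcJ. Qed.

Lemma nm_sqr z : (nm z ^+ 2)%:C = z * z^*%C.
Proof. by rewrite rmorphXn /= nmE sqr_normc. Qed.

End ComplexModulus.

(** * Integers of [K]: closure properties, discreteness, covering of the plane *)

(** [z] is a root of the monic polynomial [X^2 - t X + n], and integrality is transitive. *)
Lemma quadratic_integral (A F : comNzRingType) (f : {rmorphism A -> F}) (t n z : F) :
  integralOver f t -> integralOver f n -> z ^+ 2 = t * z - n -> integralOver f z.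
Proof.
move=> it inn zE; pose p := 'X^2 + (n%:P - t *: 'X).
apply: (@integral_root_monic _ _ f z p).
- rewrite monicE lead_coefDl ?lead_coefXn // size_polyXn.
  rewrite (leq_ltn_trans (size_polyD _ _)) // gtn_max size_polyN.
  rewrite (leq_ltn_trans (size_polyC_leq1 _)) //.
  by rewrite (leq_ltn_trans (size_scale_leq _ _)) // size_polyX.
- rewrite /root /p hornerD hornerXn zE hornerD hornerN hornerC hornerZ hornerX.
  by apply/eqP; ring.
- apply/integral_poly => i; rewrite coefD coefB coefZ coefX coefXn coefC.
  apply: integral_add; first exact: integral_nat.
  apply: integral_sub.
    by case: eqP => _; [exact: inn|exact: (integral_nat f 0)].
  by apply: (integral_mul (RtoK := f)) => //; exact: integral_nat.
Qed.

Section QuadraticIntegers.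
Variables (R : realType) (m : nat).
Hypothesis m_gt0 : (0 < m)%N.
Local Notation C := R[i].
Local Notation K := (@imquad C m).
Local Notation O := (@imquad_int C m).
Local Notation nm := (@Normc.normc R).
Local Notation w := (sqrtNm R m).
Local Notation zint := (integralOver (intr : int -> C)).

Lemma oint_K x : O x -> K x. Proof. by case. Qed.

Lemma oint_int (k : int) : O k%:~R.
Proof. by split; [exact: imquad_int_cst|exact: integral_id]. Qed.

Lemma oint0 : O 0. Proof. exact: (oint_int 0). Qed.
Lemma oint1 : O 1. Proof. exact: (oint_int 1). Qed.
Lemma oint_nat n : O n%:R. Proof. exact: (oint_int n). Qed.

Lemma ointB x y : O x -> O y -> O (x - y).
Proof. by move=> [? ?] [? ?]; split; [exact: imquadB|exact: integral_sub]. Qed.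

Lemma ointD x y : O x -> O y -> O (x + y).
Proof. by move=> [? ?] [? ?]; split; [exact: imquadD|exact: integral_add]. Qed.

Lemma ointN x : O x -> O (- x).
Proof. by move=> [? ?]; split; [exact: imquadN|exact: integral_opp]. Qed.

Lemma ointM x y : O x -> O y -> O (x * y).
Proof. by move=> [? ?] [? ?]; split; [exact: imquadM|exact: integral_mul]. Qed.

Lemma ointX x n : O x -> O (x ^+ n).
Proof. by move=> Ox; elim: n => [|n IH]; rewrite ?expr0 ?exprS; [exact: oint1|exact: ointM]. Qed.

Lemma zint_conj x : zint x -> zint x^*%C.
Proof.
case=> p pm px; exists p => //.
have -> : map_poly (intr : int -> C) p = map_poly conjc (map_poly intr p).
  by rewrite -map_poly_comp; apply: eq_map_poly => k /=; rewrite rmorph_int.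
by rewrite rmorph_root.
Qed.

Lemma oint_conj x : O x -> O x^*%C.
Proof. by move=> [? ?]; split; [exact: imquad_conj|exact: zint_conj]. Qed.

Lemma zint_sqrt x : zint (x ^+ 2) -> zint x.
Proof.
move=> ix; apply: (@quadratic_integral _ _ _ 0 (- x ^+ 2)).
- by case: oint0.
- exact: integral_opp.
- by rewrite mul0r sub0r opprK.
Qed.

Lemma oint_sqrt_closed x : K x -> O (x ^+ 2) -> O x.
Proof. by move=> Kx [_ /zint_sqrt]. Qed.

Lemma oint_sqrtNm : O w.
Proof.
apply: oint_sqrt_closed; first exact: imquad_sqrt.
by rewrite sqrtNm_sqr; exact/ointN/oint_nat.
Qed.

Lemma oint_rat (u : rat) : O (ratr u) -> exists k : int, u = k%:~R.
Proof. by case=> _; exact: rat_integral_int. Qed.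

Lemma oint_real x : O x -> x^*%C = x -> exists k : int, x = k%:~R.
Proof.
move=> Ox /(imquad_real m_gt0 (oint_K Ox))[u uE]; move: Ox; rewrite uE.
by move=> /oint_rat[k ->]; exists k; rewrite ratr_int.
Qed.

Lemma oint_norm x : O x -> exists n : nat, x * x^*%C = n%:R.
Proof.
move=> Ox; have [||k kE] := @oint_real (x * x^*%C).
- exact/ointM/oint_conj.
- by rewrite rmorphM /= conjcK mulrC.
have : 0 <= x * x^*%C by exact: mulcJ_ge0.
rewrite kE ler0z; by case: k kE => // n kE _; exists n.
Qed.

Lemma oint_nm x : O x -> exists n : nat, nm x ^+ 2 = n%:R.
Proof.
move=> /oint_norm[n nE]; exists n; apply: (@complexI R).
by rewrite nm_sqr nE rmorph_nat.
Qed.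

(** The squared modulus of an element of [O] is a natural number; this is the discreteness of
    [O]. *)
Lemma oint_small x : O x -> nm x < 1 -> x = 0.
Proof.
move=> /oint_nm[n nE] x1; apply/eqP; rewrite -nm_eq0 -sqrf_eq0 nE pnatr_eq0.
have : nm x ^+ 2 < 1 by rewrite expr_lt1 // ?nm_ge0.
by rewrite nE ltrn1 ltnS leqn0.
Qed.

Lemma oint_trace_norm x (s t : int) :
  K x -> x + x^*%C = s%:~R -> x * x^*%C = t%:~R -> O x.
Proof.
move=> Kx sE tE; split=> //; apply: (@quadratic_integral _ _ _ s%:~R t%:~R).
- exact: integral_id.
- exact: integral_id.
- by rewrite -sE -tE; ring.
Qed.

(** The norms of [x] and of [x + 1] have powers with denominators dividing [D ^ 2], so both are
    integers. The trace of [x] is their difference minus 1, hence an integer too. *)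
Lemma oint_bounded_denominator x (D : nat) :
  (0 < D)%N -> K x -> (forall n, O (D%:R * x ^+ n)) -> O x.
Proof.
move=> D0 Kx Dx.
have nint y : K y -> (forall n, O (D%:R * y ^+ n)) ->
    exists k : int, y * y^*%C = k%:~R.
  move=> Ky Dy; have [u uE] := imquad_norm m_gt0 Ky.
  have [||k kE] := @rat_bounded_denominator_int (D%:R ^+ 2) u.
  - by rewrite expf_neq0 // pnatr_eq0 -lt0n.
  - move=> n; apply: oint_rat; rewrite rmorphM !rmorphXn /= ratr_nat -uE.
    have -> : D%:R ^+ 2 * (y * y^*%C) ^+ n = D%:R * y ^+ n * (D%:R * y ^+ n)^*%C.
      by rewrite rmorphM rmorphXn /= rmorph_nat exprMn; ring.
    exact/ointM/oint_conj.
  - by exists k; rewrite uE kE ratr_int.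
have [t tE] := nint x Kx Dx.
have [|n|s sE] := nint (x + 1).
- exact/imquadD/imquad1.
- rewrite exprDn mulr_sumr; elim/big_ind: _ => [|a b|i _]; first exact: oint0.
    exact: ointD.
  by rewrite expr1n mulr1 -[_ *+ 'C(_, _)]mulr_natr mulrA; apply: ointM => //; exact: oint_nat.
apply: (@oint_trace_norm _ (s - t - 1) t) => //.
move: sE; rewrite rmorphD rmorph1 => sE.
by rewrite !rmorphB rmorph1 /= -sE -tE; ring.
Qed.

Lemma real_coordinates (z : C) : exists x y : R, z = x%:C + y%:C * w.
Proof.
have w0 := sqrtNm_neq0 R m_gt0; have := sqrtNm_conj R m_gt0.
case: w w0 => a b w0 /= [aE].
have a0 : a = 0 by lra.
have b0 : b != 0.
  by apply: contraNneq w0 => b0; rewrite a0 b0.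
case: z => x y; exists x, (y / b); rewrite a0.
apply/eqP; rewrite eq_complex /= !mulr0 !mul0r !subr0 !addr0 !eqxx /=.
by rewrite add0r divfK.
Qed.

(** Bounds the modulus of [x + y * w] for real [x], [y] in the unit interval, so every point of the
    plane is that close to some [a + b * w] with integers [a], [b]. *)
Definition cover_radius : R := 1 + nm w.
Local Notation C0 := cover_radius.

Lemma cover_radius_ge1 : 1 <= C0.
Proof. by rewrite lerDl nm_ge0. Qed.

Lemma nm_coordinates (x y B : R) :
  `|x| <= B -> `|y| <= B -> nm (x%:C + y%:C * w) <= B * C0.
Proof.
move=> xB yB; apply: le_trans (nmD _ _) _; rewrite nmM !nmR /cover_radius mulrDr mulr1.
by apply: lerD => //; apply: ler_wpM2r => //; exact: nm_ge0.
Qed.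

Lemma oint_coordinates (a b : int) : O (a%:~R + b%:~R * w).
Proof.
by apply: ointD; [exact: oint_int|apply: ointM; [exact: oint_int|exact: oint_sqrtNm]].
Qed.

Lemma oint_cover z : exists2 s, O s & nm (z - s) <= C0.
Proof.
have [x [y ->]] := real_coordinates z.
exists ((Num.floor x)%:~R + (Num.floor y)%:~R * w); first exact: oint_coordinates.
have -> : x%:C + y%:C * w - ((Num.floor x)%:~R + (Num.floor y)%:~R * w) =
  (x - (Num.floor x)%:~R)%:C + (y - (Num.floor y)%:~R)%:C * w.
  by rewrite !rmorphB /= !rmorph_int; ring.
rewrite -[C0]mul1r; apply: nm_coordinates; have := floor_itv x; have := floor_itv y;
  rewrite !rmorphD /= => /andP[? ?] /andP[? ?]; rewrite ger0_norm; lra.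
Qed.

End QuadraticIntegers.

(** * Dirichlet approximation over the integers of [K] *)

Section Approximation.
Variables (R : realType) (m : nat).
Hypothesis m_gt0 : (0 < m)%N.
Local Notation C := R[i].
Local Notation O := (@imquad_int C m).
Local Notation nm := (@Normc.normc R).
Local Notation w := (sqrtNm R m).
Local Notation C0 := (cover_radius R m).

Lemma trunc_eq_dist (x y : R) :
  0 <= x -> 0 <= y -> Num.truncn x = Num.truncn y -> `|x - y| <= 1.
Proof.
move=> x0 y0 xy; have /andP[h1 h2] := truncn_itv x0; have /andP[h3 h4] := truncn_itv y0.
rewrite xy in h1 h2; rewrite -natr1 in h2 h4; rewrite ler_norml; apply/andP; split; lra.
Qed.

(** Pigeonhole on the fractional parts of the two real coordinates of [zeta * q]: [(N + 1) ^ 2]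
    values of [q] fall into [N ^ 2] cells of side [1 / N]. *)
Lemma dirichlet_nat (zeta : C) (n : nat) : (0 < n)%N ->
  exists p q : C, [/\ O p, O q, q != 0, nm q <= n%:R * C0 &
    nm (p + zeta * q) <= C0 / n%:R].
Proof.
case: n => // n _; set N := n.+1.
pose X (z : C) : R := sval (cid (real_coordinates m_gt0 z)).
pose Y (z : C) : R := sval (cid (svalP (cid (real_coordinates m_gt0 z)))).
have XYE z : z = (X z)%:C + (Y z)%:C * w.
  exact: (svalP (cid (svalP (cid (real_coordinates m_gt0 z))))).
pose fr (x : R) := x - (Num.floor x)%:~R.
have fr_itv x : 0 <= fr x < 1.
  by have := floor_itv x; rewrite rmorphD /= /fr => /andP[? ?]; apply/andP; split; lra.
pose cell (x : R) : 'I_N := inord (Num.truncn (N%:R * fr x)).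
have N0 : 0 < N%:R :> R by rewrite ltr0n.
have cellP x y : cell x = cell y -> `|fr x - fr y| <= N%:R^-1.
  have trN t : (Num.truncn (N%:R * fr t) < N)%N.
    have /andP[t0 t1] := fr_itv t.
    by rewrite truncn_lt_nat ?mulr_ge0 ?ler0n // gtr_pMr.
  move=> /(congr1 (@nat_of_ord N)); rewrite !inordK ?trN // => /trunc_eq_dist.
  have /andP[x0 _] := fr_itv x; have /andP[y0 _] := fr_itv y.
  rewrite !mulr_ge0 ?ler0n // => /(_ isT isT).
  by rewrite -mulrBr normrM (gtr0_norm N0) -ler_pdivlMl // mulr1.
pose q_ (a : 'I_N.+1 * 'I_N.+1) : C := (a.1%:Z)%:~R + (a.2%:Z)%:~R * w.
pose f (a : 'I_N.+1 * 'I_N.+1) := (cell (X (zeta * q_ a)), cell (Y (zeta * q_ a))).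
have [a [b [ab fab]]] : exists a b, a != b /\ f a = f b.
  apply: contrapT => h.
  have /leq_card : injective f.
    move=> a b fab; apply/eqP; apply: contrapT => /negP ab; apply: h; by exists a, b.
  by rewrite !card_prod !card_ord leqNgt ltn_mul.
case: fab => /cellP fX /cellP fY.
(* The difference of the integer parts, so that [p + zeta * q] is the difference of two fractional
   parts in one cell. *)
pose p : C := ((Num.floor (X (zeta * q_ b)) - Num.floor (X (zeta * q_ a)))%:~R
  + (Num.floor (Y (zeta * q_ b)) - Num.floor (Y (zeta * q_ a)))%:~R * w).
pose k : int := a.1%:Z - b.1%:Z; pose l : int := a.2%:Z - b.2%:Z.
have bound (i j : 'I_N.+1) : `|(i%:Z - j%:Z)%:~R| <= N%:R :> R.
  have := ltn_ord i; have := ltn_ord j; rewrite !ltnS => iN jN.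
  have : (i%:R : R) <= N%:R by rewrite ler_nat.
  have : (j%:R : R) <= N%:R by rewrite ler_nat.
  have : 0 <= (i%:R : R) by []. have : 0 <= (j%:R : R) by [].
  by rewrite rmorphB /= => *; rewrite ler_norml; apply/andP; split; lra.
have klE : k%:~R + l%:~R * w = q_ a - q_ b by rewrite /k /l /q_ !rmorphB /=; ring.
have toC (i : int) : (i%:~R : C) = (i%:~R : R)%:C by rewrite rmorph_int.
exists p, (k%:~R + l%:~R * w); split.
- exact: oint_coordinates.
- exact: oint_coordinates.
(* If [q = k + l * w] vanishes, so does its conjugate [k - l * w]; then [k = l = 0] and the two
   colliding pairs coincide. *)
- apply: contraNneq ab => kl0.
  have conj0 : k%:~R - l%:~R * w = 0 :> C.
    have := congr1 conjc kl0.
    by rewrite rmorph0 rmorphD rmorphM /= sqrtNm_conj // !rmorph_int mulrN.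
  have k0 : k = 0.
    apply/eqP; rewrite -(intr_eq0 C); apply/eqP.
    have : 2 * k%:~R = 0 :> C by rewrite -[RHS](addr0 0) -{1}kl0 -conj0; ring.
    by move/eqP; rewrite mulf_eq0 pnatr_eq0 /= => /eqP.
  have l0 : l = 0.
    move: kl0; rewrite k0 add0r => /eqP; rewrite mulf_eq0 (negPf (sqrtNm_neq0 R m_gt0)).
    by rewrite orbF intr_eq0 => /eqP.
  move: k0 l0 => /eqP; rewrite subr_eq0 => /eqP [] k0 /eqP; rewrite subr_eq0 => /eqP [] l0.
  by apply/eqP; rewrite [a]surjective_pairing [b]surjective_pairing; congr pair; exact: val_inj.
- by rewrite !toC; apply: nm_coordinates; exact: bound.
- have -> : p + zeta * (k%:~R + l%:~R * w) =
     (fr (X (zeta * q_ a)) - fr (X (zeta * q_ b)))%:C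
     + (fr (Y (zeta * q_ a)) - fr (Y (zeta * q_ b)))%:C * w.
    rewrite klE mulrBr /p /fr.
    move: (XYE (zeta * q_ a)) (XYE (zeta * q_ b)).
    move: (X (zeta * q_ a)) (Y (zeta * q_ a)) (X (zeta * q_ b)) (Y (zeta * q_ b)).
    by move=> xa ya xb yb -> ->; rewrite !rmorphB /= !rmorph_int; ring.
  by rewrite [C0 / _]mulrC; apply: nm_coordinates.
Qed.

(** One factor [C0] comes from the error [C0 / n], the other from taking [n] as the integer part of
    [Q / C0], and 2 from [n + 1 <= 2 * n]. *)
Definition dirichlet_cst : R := 2 * C0 ^+ 2.

Lemma dirichlet (zeta : C) (Q : R) : 0 < Q ->
  exists p q : C, [/\ O p, O q, (p != 0) || (q != 0), nm q <= Q &
    nm (p + zeta * q) <= dirichlet_cst / Q].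
Proof.
move=> Q0; have C1 := cover_radius_ge1 R m.
have C_gt0 : 0 < C0 by lra.
have [QC|QC] := ltrP Q C0.
  (* For [Q] below [C0] the allowed error exceeds 1, so the trivial pair suffices. *)
  exists 1, 0; rewrite oner_neq0 mulr0 addr0 Normc.normc0 Normc.normc1; split => //.
  - exact: oint1.
  - exact: oint0.
  - exact: ltW.
  - by rewrite ler_pdivlMr // mul1r /dirichlet_cst; nra.
pose n := Num.truncn (Q / C0).
have QC0 : 1 <= Q / C0 by rewrite ler_pdivlMr // mul1r.
have /andP[n1 n2] : n%:R <= Q / C0 < n.+1%:R by apply: truncn_itv; lra.
have n0 : (0 < n)%N.
  by rewrite lt0n; apply: contraTneq QC0 => nE; rewrite -ltNge; move: n2; rewrite nE.
have [p [q [Op Oq q0 qn pq]]] := dirichlet_nat zeta n0.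
exists p, q; split => //; first by rewrite q0 orbT.
  by apply: le_trans qn _; rewrite -ler_pdivlMr.
have n1' : 1 <= n%:R :> R by rewrite ler1n.
have nR0 : 0 < n%:R :> R by lra.
apply: le_trans pq _; rewrite ler_pdivrMr // mulrAC ler_pdivlMr // /dirichlet_cst.
move: n2; rewrite -natr1 ltr_pdivrMr // => n2; nra.
Qed.

(** Total boundedness of a disc. The cells are squares of side [e / 2], so real and imaginary parts
    together contribute at most [e]. *)
Lemma bounded_grid (B e : R) : 0 <= B -> 0 < e ->
  exists (T : finType) (cell : C -> T), forall z z', nm z <= B -> nm z' <= B ->
    cell z = cell z' -> nm (z - z') <= e.
Proof.
move=> B0 e0; pose d := e / 2; have d0 : 0 < d by rewrite divr_gt0.
pose N := (Num.truncn ((B + B) / d)).+1.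
pose cell1 (x : R) : 'I_N := inord (Num.truncn ((x + B) / d)).
exists ('I_N * 'I_N)%type, (fun z => (cell1 (complex.Re z), cell1 (complex.Im z))).
have cell1P x y : `|x| <= B -> `|y| <= B -> cell1 x = cell1 y -> `|x - y| <= d.
  move=> xB yB /(congr1 (@nat_of_ord N)).
  have h t : `|t| <= B -> (0 <= (t + B) / d) && (Num.truncn ((t + B) / d) < N)%N.
    rewrite ler_norml => /andP[t1 t2]; apply/andP; split.
      by rewrite divr_ge0 //; lra.
    rewrite ltnS; apply: le_truncn; rewrite ler_pM2r ?invr_gt0 //; lra.
  have /andP[x1 x2] := h x xB; have /andP[y1 y2] := h y yB.
  rewrite !inordK // => /(trunc_eq_dist x1 y1).
  rewrite -mulrBl opprD addrACA subrr addr0 normrM [`|d^-1|]gtr0_norm ?invr_gt0 //.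
  by rewrite ler_pdivrMr // mul1r.
have ReIm z : `|complex.Re z| <= nm z /\ `|complex.Im z| <= nm z.
  case: z => x y /=; rewrite -!sqrtr_sqr; split; apply: ler_wsqrtr.
    by rewrite lerDl sqr_ge0.
  by rewrite lerDr sqr_ge0.
move=> z z' zB z'B [/cell1P hr /cell1P hi].
have [z1 z2] := ReIm z; have [z3 z4] := ReIm z'.
have {}hr := hr (le_trans z1 zB) (le_trans z3 z'B).
have {}hi := hi (le_trans z2 zB) (le_trans z4 z'B).
have {hr hi} : `|complex.Re (z - z')| <= d /\ `|complex.Im (z - z')| <= d.
  by case: z z' hr hi {zB z'B z1 z2 z3 z4} => x y [x' y'].
move: (z - z') => u [hx hy]; rewrite [u]complexE.
apply: le_trans (nmD _ _) _; rewrite nmM !nmR.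
have -> : nm 'i = 1 by rewrite /= expr0n expr1n add0r sqrtr1.
rewrite mul1r (le_trans (lerD hx hy)) // /d; lra.
Qed.

End Approximation.

(** * Discrete groups containing [SL_2(O_K)]: shape and integrality of the entries *)

Section DiscreteGroup.
Variables (R : realType) (m : nat).
Hypothesis m_gt0 : (0 < m)%N.
Local Notation C := R[i].
Local Notation K := (@imquad C m).
Local Notation O := (@imquad_int C m).
Local Notation nm := (@Normc.normc R).
Local Notation w := (sqrtNm R m).
Local Notation C0 := (cover_radius R m).

(* [g a b c d] says that the matrix [[a, b], [c, d]] belongs to a discrete
   subgroup of SL_2(C) containing SL_2(O_K). *)
Variable g : C -> C -> C -> C -> Prop.
Hypothesis gM : forall a b c d a' b' c' d', g a b c d -> g a' b' c' d' ->
  g (a * a' + b * c') (a * b' + b * d') (c * a' + d * c') (c * b' + d * d').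
Hypothesis gV : forall a b c d, g a b c d -> g d (- b) (- c) a.
Hypothesis g_det : forall a b c d, g a b c d -> a * d - b * c = 1.
Hypothesis gO : forall a b c d, O a -> O b -> O c -> O d ->
  a * d - b * c = 1 -> g a b c d.
Hypothesis g_discrete : exists2 e : R, 0 < e & forall a b c d, g a b c d ->
  nm (a - 1) < e -> nm b < e -> nm c < e -> nm (d - 1) < e ->
  [/\ a = 1, b = 0, c = 0 & d = 1].

Lemma g_T_mul s a b c d : O s -> g a b c d -> g (a + s * c) (b + s * d) c d.
Proof.
move=> Os gM0; have gT : g 1 s 0 1.
  by apply: gO => //; [exact: oint1|exact: oint0|exact: oint1|rewrite mulr0 subr0 mulr1].
have := gM gT gM0; by rewrite !mul1r !mul0r !add0r.
Qed.

Lemma g_W : g 0 (- 1) 1 0.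
Proof.
apply: gO; [exact: oint0|exact/ointN/oint1|exact: oint1|exact: oint0|].
by rewrite mul0r mulN1r sub0r opprK.
Qed.

Lemma g_W_mul a b c d : g a b c d -> g (- c) (- d) a b.
Proof.
move=> gM0.
by have := gM g_W gM0; rewrite !mul0r !mul1r !mulN1r !add0r !addr0.
Qed.

Lemma g_mul_W a b c d : g a b c d -> g b (- a) d (- c).
Proof.
move=> gM0.
by have := gM gM0 g_W; rewrite !mulr0 !mulr1 !mulrN1 !add0r !addr0.
Qed.

Definition gorbit (x y : C) := exists a b c d p q,
  [/\ g a b c d, O p, O q, x = a * p + b * q & y = c * p + d * q].

(* The conjugate by g of the unipotent 1 + v (Jv)^T, where v = (p, q). *)
Lemma gorbit_unipotent x y : gorbit x y ->
  g (1 - x * y) (x ^+ 2) (- y ^+ 2) (1 + x * y).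
Proof.
move=> [a [b [c [d [p [q [gM0 Op Oq -> ->]]]]]]].
have gU : g (1 - p * q) (p ^+ 2) (- q ^+ 2) (1 + p * q).
  apply: gO; [apply: ointB|exact: ointX|exact/ointN/ointX|apply: ointD|];
    do ?[exact: oint1|exact: ointM].
  by ring.
have := gM (gM gM0 gU) (gV gM0); have D := g_det gM0.
set X := a * p + b * q; set Y := c * p + d * q.
congr g.
- transitivity ((a * d - b * c) - X * Y); last by rewrite D.
  by rewrite /X /Y; ring.
- by rewrite /X; ring.
- by rewrite /Y; ring.
- transitivity ((a * d - b * c) + X * Y); last by rewrite D.
  by rewrite /X /Y; ring.
Qed.

Lemma gorbit_T x y s : O s -> gorbit x y -> gorbit (x + s * y) y.
Proof.
move=> Os [a [b [c [d [p [q [gM0 Op Oq -> ->]]]]]]].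
exists (a + s * c), (b + s * d), c, d, p, q; split=> //; first exact: g_T_mul.
by ring.
Qed.

(** A short vector has a unipotent close to 1, hence equal to 1, so [x ^+ 2 = y ^+ 2 = 0]. Capping
    the radius at 1 keeps the products of two coordinates below [e]. *)
Lemma gorbit_min : exists2 e : R, 0 < e &
  forall x y, gorbit x y -> nm x < e -> nm y < e -> x = 0 /\ y = 0.
Proof.
have [e e0 he] := g_discrete; exists (Num.min e 1); first by rewrite lt_min e0 ltr01.
move=> x y /gorbit_unipotent /he h; rewrite !lt_min => /andP[xe x1] /andP[ye y1].
have x0 := nm_ge0 x; have y0 := nm_ge0 y.
case: h.
- rewrite addrAC subrr add0r nmN nmM; nra.
- rewrite nmX expr2; nra.
- rewrite nmN nmX expr2; nra.
- rewrite addrAC subrr add0r nmM; nra.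
move=> _ /eqP + /eqP; rewrite oppr_eq0 !sqrf_eq0 => /eqP -> /eqP ->; by [].
Qed.

(* Translating by T_s makes x at most C0 |y|, so that a small y forces the
   whole vector, hence the associated unipotent minus 1, to be small. *)
Lemma gorbit_snd_min : exists2 e : R, 0 < e &
  forall x y, gorbit x y -> nm y < e -> y = 0.
Proof.
have [e e0 he] := gorbit_min; have C1 := cover_radius_ge1 R m.
have C_gt0 : 0 < C0 by lra.
exists (e / C0); first by rewrite divr_gt0.
move=> x y oxy; rewrite ltr_pdivlMr // => ye.
have [//|y0] := eqVneq y 0.
have [s Os hs] := oint_cover m_gt0 (- (x / y)).
have h : nm (x + s * y) <= C0 * nm y.
  have -> : x + s * y = - (- (x / y) - s) * y by field.
  by rewrite nmM nmN ler_wpM2r // nm_ge0.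
have ny := nm_ge0 y.
have [] // := he _ _ (gorbit_T Os oxy).
- by rewrite (le_lt_trans h) // mulrC.
- nra.
Qed.

(** Dirichlet approximation of [d / c] makes the second coordinate [c * p + d * q] of an orbit
    vector smaller than the gap, so it is 0 and [d / c = - p / q]. *)
Lemma g_row_ratio a b c d : g a b c d -> c != 0 -> K (d / c).
Proof.
move=> gM0 c0; have [e e0 he] := gorbit_snd_min.
pose Dc := dirichlet_cst R m.
have Dc0 : 0 < Dc by rewrite mulr_gt0 // exprn_gt0 // (lt_le_trans ltr01 (cover_radius_ge1 _ _)).
have nc0 : 0 < nm c by rewrite nm_gt0.
(* Chosen so that [nm c * (Dc / Q) = e / 2]. *)
pose Q := 2 * (nm c * Dc) / e.
have Q0 : 0 < Q by rewrite divr_gt0 // mulr_gt0 // mulr_gt0.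
have [p [q [Op Oq pq0 _ pq]]] := dirichlet m_gt0 (d / c) Q0.
have E : c * p + d * q = c * (p + d / c * q) by field.
have h0 : c * p + d * q = 0.
  apply: (he (a * p + b * q)).
    by exists a, b, c, d, p, q.
  rewrite E nmM; apply: (@le_lt_trans _ _ (nm c * (Dc / Q))); first by rewrite ler_pM2l.
  have -> : nm c * (Dc / Q) = e / 2.
    by rewrite /Q; field; rewrite !lt0r_neq0.
  lra.
move/eqP: h0; rewrite E mulf_eq0 (negPf c0) /= => /eqP h0.
have q0 : q != 0.
  apply: contraTneq pq0 => q0; move: h0; rewrite q0 mulr0 addr0 => ->.
  by rewrite eqxx.
have -> : d / c = - p / q.
  apply: (mulIf q0); rewrite divfK //; apply/eqP; rewrite -subr_eq0 opprK addrC.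
  by rewrite h0.
by apply: imquad_div; [apply: imquadN; case: Op|case: Oq].
Qed.

(** One takes [l = c], or [l = a] when [c = 0]. The ratios [a / c] and [d / c] are in [K] by
    [g_row_ratio], and [d / c - b / a = 1 / (a * c)] then gives [c ^+ 2]. If [a = 0], the row
    [(a, b)] is first replaced by its sum with [(c, d)]. *)
Lemma g_rational_form a b c d : g a b c d -> exists l : C,
  [/\ l != 0, K (l ^+ 2), K (a / l), K (b / l) & (K (c / l) /\ K (d / l))].
Proof.
have main a' b' c' d' : g a' b' c' d' -> c' != 0 ->
    [/\ K (c' ^+ 2), K (a' / c'), K (b' / c') & K (d' / c')].
  move: a' b' c' d' => {}a {}b {}c {}d gM0 c0.
  have D := g_det gM0.
  have Kd := g_row_ratio gM0 c0.
  have Ka : K (a / c).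
    have := g_row_ratio (gV gM0); rewrite oppr_eq0 => /(_ c0).
    by rewrite invrN mulrN => /imquadN; rewrite opprK.
  have bE : b = (a * d - 1) / c by rewrite -D; field.
  have Kc : K (c ^+ 2).
    have [a0|a0] := eqVneq a 0.
      have := g_row_ratio (g_W_mul (g_T_mul (oint1 R m) gM0)).
      rewrite a0 mul1r add0r mul1r => /(_ c0) h.
      have := imquadB Kd h.
      have -> : d / c - (b + d) / c = (c ^+ 2)^-1 by rewrite bE a0; field.
      by move=> /imquadV; rewrite invrK.
    have h := g_row_ratio (g_W_mul gM0) a0.
    have := imquadB Kd h.
    have -> : d / c - b / a = (a * c)^-1 by rewrite bE; field; rewrite ?a0 ?c0.
    move=> /imquadV; rewrite invrK => Kac; have := imquad_div Kac Ka.
    by have -> : a * c / (a / c) = c ^+ 2 by field; rewrite ?a0 ?c0.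
  split=> //.
  have -> : b / c = a / c * (d / c) - (c ^+ 2)^-1 by rewrite bE; field.
  by apply: imquadB; [exact: imquadM|exact: imquadV].
move=> gM0; have D := g_det gM0.
have [c0|c0] := eqVneq c 0; last first.
  have [? ? ? ?] := main _ _ _ _ gM0 c0; exists c; split=> //; split=> //.
  by rewrite divff //; exact: imquad1.
have a0 : a != 0.
  by apply: contra_eq_neq D => ->; rewrite c0 mul0r mulr0 subr0 eq_sym oner_neq0.
(* The lower unipotent that adds the first row to the second is [W^3 T W] with [T] the translation
   by -1, and [W^3] is the inverse of [W]. *)
have gM1 : g a b (a + c) (b + d).
  have := g_W_mul (g_T_mul (ointN (oint1 R m)) (g_W_mul gM0)).
  move=> /g_W_mul /g_W_mul; rewrite !mulN1r; congr g; ring.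
have := main _ _ _ _ gM1; rewrite c0 addr0 => /(_ a0) [Ka2 _ Kb Kbd].
exists a; split=> //; first by rewrite divff //; exact: imquad1.
split; first by rewrite mul0r; exact: imquad0.
by have -> : d / a = (b + d) / a - b / a by [field]; exact: imquadB.
Qed.


Lemma imquad_denominator x : K x -> exists2 D : nat, (0 < D)%N & O (D%:R * x).
Proof.
move=> /(imquadP m_gt0)[u [v ->]].
have den (t : rat) : exists2 D : nat, (0 < D)%N & O (D%:R * ratr t).
  exists `|denq t|%N; first by rewrite absz_gt0 denq_neq0.
  have -> : `|denq t|%N%:R = ratr (denq t)%:~R :> C.
    by rewrite ratr_int natr_absz gtr0_norm ?denq_gt0.
  rewrite -rmorphM /= [_ * t]mulrC -numqE ratr_int; exact: oint_int.
have [D D0 HD] := den u; have [E E0 HE] := den v.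
exists (D * E)%N; first by rewrite muln_gt0 D0.
have -> : (D * E)%:R * (ratr u + ratr v * w) =
    E%:R * (D%:R * ratr u) + D%:R * (E%:R * ratr v) * w.
  by rewrite natrM; ring.
apply: ointD; first by apply: ointM => //; exact: oint_nat.
by apply: ointM; [apply: ointM => //; exact: oint_nat|exact: oint_sqrtNm].
Qed.

(** The unipotents of two nearby bounded vectors have a quotient close to 1. They are therefore
    equal, and so are their lower left entries. *)
Lemma gorbit_close (B : R) : 1 <= B -> exists2 e : R, 0 < e &
  forall x y x' y', gorbit x y -> gorbit x' y' ->
    nm x <= B -> nm y <= B -> nm x' <= B -> nm y' <= B ->
    nm (x - x') <= e -> nm (y - y') <= e -> y ^+ 2 = y' ^+ 2.
Proof.
move=> B1; have [e e0 he] := g_discrete.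
(* Each entry of the quotient minus 1 is at most [2 * B * d + B ^+ 2 * (2 * B * d)], which this
   choice makes [e / 2]. *)
pose d := e / (4 * B * (1 + B ^+ 2)).
have B2 : 0 < 4 * B * (1 + B ^+ 2) by nra.
have dE : 2 * B * d * (1 + B ^+ 2) = e / 2.
  by rewrite /d; field; apply/andP; split; apply: lt0r_neq0; nra.
have d0 : 0 < d by rewrite divr_gt0.
exists d => // x y x' y' o o' xB yB x'B y'B xx' yy'.
have := gM (gorbit_unipotent o) (gV (gorbit_unipotent o')).
have prodB s s' t t' : nm s <= B -> nm t' <= B -> nm (s - s') <= d -> nm (t - t') <= d ->
    nm (s * t - s' * t') <= 2 * B * d.
  move=> sB tB sd td.
  have -> : s * t - s' * t' = s * (t - t') + (s - s') * t' by ring.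
  apply: le_trans (nmD _ _) _; rewrite !nmM.
  have := nm_ge0 s; have := nm_ge0 t'; have := nm_ge0 (s - s'); have := nm_ge0 (t - t'); nra.
have DB : nm (x * y' - y * x') <= 2 * B * d.
  have -> : x * y' - y * x' = (x - x') * y' - (y - y') * x' by ring.
  apply: le_trans (nmB _ _) _; rewrite !nmM.
  have := nm_ge0 x'; have := nm_ge0 y'; have := nm_ge0 (x - x'); have := nm_ge0 (y - y'); nra.
have small s t u : nm s <= 2 * B * d -> nm t <= B -> nm u <= B ->
    nm (s + t * u * (x * y' - y * x')) < e.
  move=> sB tB uB; apply: le_lt_trans (nmD _ _) _; rewrite !nmM.
  have tu : nm t * nm u <= B ^+ 2.
    by rewrite expr2; apply: ler_pM => //; exact: nm_ge0.
  have : nm t * nm u * nm (x * y' - y * x') <= B ^+ 2 * (2 * B * d).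
    by apply: ler_pM => //; rewrite ?mulr_ge0 ?nm_ge0.
  by move=> h; apply: le_lt_trans (lerD sB h) _; lra.
have sym s t : nm (s - t) = nm (t - s) by rewrite -nmN opprB.
move=> /he h.
have {h}[] := h.
- have -> : (1 - x * y) * (1 + x' * y') + x ^+ 2 * - - y' ^+ 2 - 1 =
    (x' * y' - x * y) + x * y' * (x * y' - y * x') by ring.
  by apply: small => //; apply: prodB => //; rewrite sym.
- have -> : (1 - x * y) * - x' ^+ 2 + x ^+ 2 * (1 - x' * y') =
    (x * x - x' * x') + (- x) * x' * (x * y' - y * x') by ring.
  by apply: small => //; rewrite ?nmN //; apply: prodB.
- have -> : - y ^+ 2 * (1 + x' * y') + (1 + x * y) * - - y' ^+ 2 =
    (y' * y' - y * y) + y * y' * (x * y' - y * x') by ring.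
  by apply: small => //; apply: prodB => //; rewrite sym.
- have -> : - y ^+ 2 * - x' ^+ 2 + (1 + x * y) * (1 - x' * y') - 1 =
    (x * y - x' * y') + (- y) * x' * (x * y' - y * x') by ring.
  by apply: small => //; rewrite ?nmN //; apply: prodB.
move=> _ _ h21 h22.
(* Multiplying the bottom row [(0, 1)] of the quotient by the second unipotent recovers the lower
   left entry of the first. *)
apply: oppr_inj; transitivity
  ((- y ^+ 2 * (1 + x' * y') + (1 + x * y) * - - y' ^+ 2) * (1 - x' * y')
   - (- y ^+ 2 * - x' ^+ 2 + (1 + x * y) * (1 - x' * y')) * y' ^+ 2); first by ring.
by rewrite h21 h22; ring.
Qed.

(** On each pair of grid cells [y ^+ 2] takes a single value, so the product of finitely many
    denominators works for all. *)
Lemma gorbit_bounded_denominator (B : R) : 1 <= B -> exists2 D : nat, (0 < D)%N &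
  forall x y, gorbit x y -> K (y ^+ 2) -> nm x <= B -> nm y <= B -> O (D%:R * y ^+ 2).
Proof.
move=> B1; have [e e0 he] := gorbit_close B1.
have [|T [cell cellP]] := @bounded_grid R B e _ e0; first lra.
pose good (t : T * T) x y := [/\ gorbit x y, K (y ^+ 2), nm x <= B, nm y <= B
  & (cell x, cell y) = t].
have den t : exists D : nat, (0 < D)%N /\
    forall x y, good t x y -> O (D%:R * y ^+ 2).
  have [[x [y [oxy Ky xB yB xyt]]]|no] := pselect (exists x y, good t x y).
    have [D D0 HD] := imquad_denominator Ky; exists D; split=> //.
    move=> x' y' [oxy' _ x'B y'B]; rewrite -xyt => -[cx cy].
    by rewrite -(he x y x' y') //; apply: cellP.
  by exists 1%N; split=> // x y gxy; case: no; exists x, y.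
pose D t := sval (cid (den t)).
have D_gt0 t : (0 < D t)%N by case: (svalP (cid (den t))).
have HD t : forall x y, good t x y -> O ((D t)%:R * y ^+ 2).
  by case: (svalP (cid (den t))).
exists (\prod_t D t)%N; first exact: prodn_gt0.
move=> x y o Ky xB yB; rewrite (bigD1 (cell x, cell y)) //= mulnC natrM -mulrA.
by apply: ointM; [exact: oint_nat|apply: (HD _ x); split].
Qed.

(** Two independent orbit vectors, bounded independently of the matrix, have second coordinates
    [y1], [y2] with a common denominator. Then [c * dt = y1 * q2 - y2 * q1], where the determinant
    [dt] is an integer of [K] of bounded norm. *)
Lemma g_bounded_denominator : exists2 D : nat, (0 < D)%N &
  forall a b c d, g a b c d -> K a -> K b -> K c -> K d -> O (D%:R * c).
Proof.
have [e1 e1_gt0 he1] := gorbit_min; have C1 := cover_radius_ge1 R m.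
pose Dc := dirichlet_cst R m.
have Dc1 : 1 <= Dc by rewrite /Dc /dirichlet_cst expr2; nra.
pose e := e1 / (C0 + 1).
have e_gt0 : 0 < e by rewrite divr_gt0 //; lra.
have eE : (C0 + 1) * e = e1 by rewrite /e; field; apply: lt0r_neq0; lra.
(* Large enough for [Dc / k < e], [1 / k < e] and [Dc / k ^+ 2 < e ^+ 2]. *)
pose k := 1 + Dc / e + Dc / e ^+ 2.
have De0 : 0 < Dc / e by rewrite divr_gt0 //; lra.
have De1 : 0 < Dc / e ^+ 2 by rewrite divr_gt0 ?exprn_gt0 //; lra.
have k1 : 1 <= k by rewrite /k; lra.
have k0 : 0 < k by lra.
have ki1 : k^-1 <= 1 by rewrite invf_le1; [exact: k1|exact: k0].
have De : Dc / k < e.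
  rewrite ltr_pdivrMr //.
  have -> : e * k = e + Dc + Dc / e by rewrite /k; field; exact: lt0r_neq0.
  lra.
have ke : k^-1 < e.
  by apply: le_lt_trans De; rewrite -[X in X <= _]mul1r ler_pM2r ?invr_gt0.
have Dk : Dc / k * k^-1 < e ^+ 2.
  have ki0 : 0 < k^-1 by rewrite invr_gt0.
  by rewrite expr2; apply: ltr_pM => //; rewrite ?divr_ge0 //; lra.
(* Bounds both coordinates of either vector, given [|y| <= Dc * k], [|q / c| <= k] and
   [|x| <= C0 * |y| + |q / c|]. *)
pose B := C0 * (Dc * k) + k + Dc * k.
have Dk0 : 0 <= Dc * k by rewrite mulr_ge0; lra.
have CDk0 : 0 <= C0 * (Dc * k) by rewrite mulr_ge0 //; lra.
have B1 : 1 <= B by rewrite /B; lra.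
have [D D0 HD] := gorbit_bounded_denominator B1.
pose B2 := Dc / k * k^-1 + Dc * k * k.
pose n0 := (Num.truncn (B2 ^+ 2)).+1.
exists (D * n0`!)%N; first by rewrite muln_gt0 D0 fact_gt0.
move=> a b c d gM0 Ka Kb Kc Kd.
have [->|c0] := eqVneq c 0; first by rewrite mulr0; exact: oint0.
have nc0 : 0 < nm c by rewrite nm_gt0.
(* A translation on the left leaves [c] and [d] unchanged and brings [a / c] within [C0] of 0. *)
have [s Os hs] := oint_cover m_gt0 (- (a / c)).
pose a' := a + s * c; pose b' := b + s * d.
have gM1 : g a' b' c d by exact: g_T_mul.
have D1 := g_det gM1.
have bE : b' = (a' * d - 1) / c by rewrite -D1; field.
have ac : nm (a' / c) <= C0.
  by rewrite -nmN; have -> : - (a' / c) = - (a / c) - s by rewrite /a'; field.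
(* With [y = c * p + d * q] and [z = q / c], the first coordinate is [(a' / c) * y - z]. Hence [y]
   and [z] are not both below [e]: the vector would vanish, and with it [p] and [q]. *)
have vec Q : 0 < Q -> exists p q, [/\ O p, O q, nm (q / c) <= Q,
    nm (c * p + d * q) <= Dc / Q & (nm (c * p + d * q) < e -> nm (q / c) < e -> False)].
  move=> Q0; have Qc : 0 < Q * nm c by rewrite mulr_gt0.
  have [p [q [Op Oq pq0 qQ pqQ]]] := dirichlet m_gt0 (d / c) Qc.
  exists p, q; split=> //.
  - by rewrite nmM nmV ler_pdivrMr.
  - have -> : c * p + d * q = c * (p + d / c * q) by field.
    rewrite nmM; apply: (@le_trans _ _ (nm c * (Dc / (Q * nm c)))).
      by rewrite ler_pM2l.
    by rewrite le_eqVlt; apply/orP; left; apply/eqP; field; rewrite !lt0r_neq0.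
  - move=> ye ze.
    have xE : a' * p + b' * q = a' / c * (c * p + d * q) - q / c by rewrite bE; field.
    have [|||x0 y0] := he1 (a' * p + b' * q) (c * p + d * q).
    + by exists a', b', c, d, p, q.
    + rewrite xE; apply: le_lt_trans (nmB _ _) _; rewrite nmM.
      have := nm_ge0 (a' / c); have := nm_ge0 (c * p + d * q); nra.
    + nra.
    + have q0 : q = 0.
        by rewrite -[q]mul1r -D1; transitivity (a' * (c * p + d * q) - c * (a' * p + b' * q));
          [ring|rewrite x0 y0 !mulr0 subrr].
      move: y0 pq0; rewrite q0 mulr0 addr0 eqxx orbF => /eqP.
      by rewrite mulf_eq0 (negPf c0) /= => ->.
have [p1 [q1 [Op1 Oq1 z1 y1 h1]]] := vec k k0.
have [|p2 [q2 [Op2 Oq2 z2 y2 h2]]] := vec k^-1; first by rewrite invr_gt0.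
rewrite invrK in y2.
have z1e : e <= nm (q1 / c) by rewrite leNgt; apply/negP; apply: h1; exact: le_lt_trans y1 De.
have y2e : e <= nm (c * p2 + d * q2).
  by rewrite leNgt; apply/negP => h; apply: h2 => //; exact: le_lt_trans z2 ke.
(* The scales [k] and [1 / k] make [y1] and [z2] small, which forces [y2] and [z1] to be at least
   [e] in modulus. So [dt = y1 * z2 - y2 * z1] cannot vanish. *)
pose dt := p1 * q2 - p2 * q1.
have dtE : (c * p1 + d * q1) * (q2 / c) - (c * p2 + d * q2) * (q1 / c) = dt.
  by rewrite /dt; field.
have Odt : O dt by apply: ointB; exact: ointM.
have yz : nm ((c * p1 + d * q1) * (q2 / c)) <= Dc / k * k^-1.
  by rewrite nmM; apply: ler_pM => //; exact: nm_ge0.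
have dt0 : dt != 0.
  apply/negP => /eqP dt0; move/eqP: dtE; rewrite dt0 subr_eq0 => /eqP yzE.
  move: yz; rewrite yzE nmM; have := ler_pM (ltW e_gt0) (ltW e_gt0) y2e z1e.
  by rewrite -expr2; lra.
have dtB : nm dt <= B2.
  rewrite -dtE; apply: le_trans (nmB _ _) _; apply: lerD => //.
  by rewrite nmM; apply: ler_pM => //; exact: nm_ge0.
have Dy p q : O p -> O q -> nm (c * p + d * q) <= Dc * k -> nm (q / c) <= k ->
    O (D%:R * (c * p + d * q)).
  move=> Op Oq yB zB.
  have Ky : K (c * p + d * q).
    by apply: imquadD; apply: imquadM => //; [case: Op|case: Oq].
  (* [(D * y) ^+ 2] is [D] times the integer [D * y ^+ 2], and [D * y] lies in [K]. *)
  apply: oint_sqrt_closed.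
    by apply: imquadM => //; case: (oint_nat R m D).
  rewrite exprMn expr2 -mulrA; apply: ointM; first exact: oint_nat.
  apply: (HD (a' * p + b' * q)).
  - by exists a', b', c, d, p, q.
  - exact: imquadX.
  - have -> : a' * p + b' * q = a' / c * (c * p + d * q) - q / c by rewrite bE; field.
    apply: le_trans (nmB _ _) _; rewrite nmM /B.
    have := nm_ge0 (a' / c); have := nm_ge0 (c * p + d * q); nra.
  - by rewrite /B; lra.
have Dy1 : O (D%:R * (c * p1 + d * q1)).
  apply: Dy => //; apply: le_trans y1 _; rewrite ler_pM2l; last lra.
  exact: le_trans ki1 k1.
have Dy2 : O (D%:R * (c * p2 + d * q2)).
  by apply: Dy => //; apply: le_trans z2 _; exact: le_trans ki1 k1.
have [n nE] := oint_norm m_gt0 Odt.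
have n_gt0 : (0 < n)%N.
  rewrite lt0n -(pnatr_eq0 C) -nE mulf_eq0 negb_or dt0 /=.
  by rewrite conjc_eq0.
have n_le : (n <= n0)%N.
  rewrite -(ler_nat R) /n0; apply: le_trans (ltW (truncnS_gt _)).
  have -> : n%:R = nm dt ^+ 2.
    by apply: (@complexI R); rewrite nm_sqr nE rmorph_nat.
  by rewrite ler_pXn2r // ?nnegrE ?nm_ge0 // (le_trans (nm_ge0 _) dtB).
have /dvdnP[u uE] : (n %| n0`!)%N by rewrite dvdn_fact // n_gt0.
(* The norm [n = dt * dt^*] divides [n0!], so dividing by [dt] amounts to multiplying by [dt^*]
   within this factorial. *)
have -> : (D * n0`!)%:R * c =
    u%:R * dt^*%C * (D%:R * (c * p1 + d * q1) * q2 - D%:R * (c * p2 + d * q2) * q1).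
  have -> : D%:R * (c * p1 + d * q1) * q2 - D%:R * (c * p2 + d * q2) * q1 = D%:R * c * dt.
    by rewrite /dt; ring.
  by rewrite uE !natrM -nE; ring.
apply: ointM; first by apply: ointM; [exact: oint_nat|exact: oint_conj].
by apply: ointB; apply: ointM.
Qed.

Lemma g_rational_integral a b c d :
  g a b c d -> K a -> K b -> K c -> K d -> O c.
Proof.
move=> gM0 Ka Kb Kc Kd; have [D D0 HD] := g_bounded_denominator.
apply: (@oint_bounded_denominator R m m_gt0 c D) => // n.
(* Strengthened for the induction: one factor [c] becomes the lower left entry of an arbitrary
   element over [K]. *)
suff h k a' b' c' d' : g a' b' c' d' -> K a' -> K b' -> K c' -> K d' ->
    O (D%:R * c ^+ k * c').
  case: n => [|n]; first by rewrite expr0 mulr1; exact: oint_nat.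
  by rewrite exprSr mulrA; exact: h gM0 _ _ _ _.
elim: k a' b' c' d' => [|k IH] a' b' c' d' gM1 Ka' Kb' Kc' Kd'.
  by rewrite expr0 mulr1; exact: HD gM1 _ _ _ _.
have cl x y z t : K x -> K y -> K z -> K t -> K (x * y + z * t).
  by move=> *; apply: imquadD; exact: imquadM.
have gT : g a' b' c' d' -> g (a' + c') (b' + d') c' d'.
  by move=> /(g_T_mul (oint1 R m)); rewrite !mul1r.
have h1 := IH _ _ _ _ (gM gM0 gM1).
have h2 := IH _ _ _ _ (gM gM0 (gT gM1)).
have -> : D%:R * c ^+ k.+1 * c' =
    D%:R * c ^+ k * (c * (a' + c') + d * c') - D%:R * c ^+ k * (c * a' + d * c').
  by rewrite exprS; ring.
by apply: ointB; [apply: h2|apply: h1]; apply: cl => //; exact: imquadD.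
Qed.

(** The unipotent of the first column has lower left entry [- c ^+ 2] and entries in [K], since a
    product of two entries is [l ^+ 2] times an element of [K]. Multiplication by [W] moves the
    other entries to the lower left corner. *)
Lemma g_entry_sqr a b c d :
  g a b c d -> [/\ O (a ^+ 2), O (b ^+ 2), O (c ^+ 2) & O (d ^+ 2)].
Proof.
have main a' b' c' d' : g a' b' c' d' -> O (c' ^+ 2).
  move=> gM0; have [l [l0 Kl Ka Kb [Kc Kd]]] := g_rational_form gM0.
  have lM x y : K (x / l) -> K (y / l) -> K (x * y).
    move=> Kx Ky; have -> : x * y = x / l * (y / l) * l ^+ 2 by field.
    by apply: imquadM => //; exact: imquadM.
  have /gorbit_unipotent gU : gorbit a' c'.
    exists a', b', c', d', 1, 0; split=> //; [exact: oint1|exact: oint0| |];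
    by rewrite mulr1 mulr0 addr0.
  rewrite -[c' ^+ 2]opprK; apply: ointN; apply: g_rational_integral gU _ _ _ _.
  - by apply: imquadB; [exact: imquad1|exact: lM].
  - exact: lM.
  - by apply: imquadN; exact: lM.
  - by apply: imquadD; [exact: imquad1|exact: lM].
move=> gM0; split.
- exact: main (g_W_mul gM0).
- exact: main (g_W_mul (g_mul_W gM0)).
- exact: main gM0.
- exact: main (g_mul_W gM0).
Qed.

End DiscreteGroup.

(** * Integrality of products of entries with conjugate entries *)

Section ConjugateProducts.
Variables (R : realType) (m : nat).
Hypothesis m_gt0 : (0 < m)%N.
Local Notation C := R[i].
Local Notation K := (@imquad C m).
Local Notation O := (@imquad_int C m).
Local Notation zint := (integralOver (intr : int -> C)).

(* The ideal generated by the products x y^* of the entries of a matrix with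
   these properties is principal, generated by a real number rho (the gcd of
   the real numbers x x^* and x y^* + x^* y), and the determinant condition
   makes it the unit ideal, whence rho = 1. *)
Lemma entry_conj_products (l : C) (M : 'I_2 -> 'I_2 -> C) :
  l != 0 -> K (l ^+ 2) -> (forall i j, K (M i j / l)) ->
  (forall i j, O (M i j ^+ 2)) -> M 0 0 * M 1 1 - M 0 1 * M 1 0 = 1 ->
  forall i j i' j', O (M i j * (M i' j')^*%C).
Proof.
move=> l0 Kl2 KM OM detM.
pose r := l * l^*%C.
have rJ : r^*%C = r by rewrite /r rmorphM /= conjcK mulrC.
have r0 : r != 0 by rewrite mulf_neq0 // conjc_eq0.
have [r2 r2E] : exists u : rat, r ^+ 2 = ratr u.
  have [u uE] := imquad_norm m_gt0 Kl2; exists u.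
  by rewrite -uE /r rmorphXn /= exprMn.
(* [L] is the additive group of algebraic integers in [r] times the rationals. Squares of its
   elements are natural numbers, so a nonzero element [rho] of least square exists. *)
pose L y := (exists t : rat, y = r * ratr t) /\ zint y.
have LJ y : L y -> y^*%C = y.
  by case=> -[t ->] _; rewrite rmorphM /= rJ ratr_conj.
have Lsq y : L y -> exists n : nat, y ^+ 2 = n%:R.
  move=> Ly; have yJ := LJ _ Ly; case: Ly => -[t tE] iy.
  have [k kE] : exists k : int, y ^+ 2 = k%:~R.
    have : zint (ratr (r2 * t ^+ 2) : C).
      rewrite rmorphM rmorphXn /= -r2E -exprMn -tE expr2; exact: integral_mul.
    move=> /rat_integral_int[k kE]; exists k.
    by rewrite -ratr_int -kE rmorphM rmorphXn /= -r2E -exprMn -tE.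
  have : 0 <= y ^+ 2 by rewrite expr2 -{2}yJ; exact: mulcJ_ge0.
  by rewrite kE ler0z; case: k kE => // n kE _; exists n.
have zM i j i' j' : zint (M i j * (M i' j')^*%C).
  apply: (@zint_sqrt R m); rewrite exprMn -rmorphXn /=.
  by apply: integral_mul; [case: (OM i j)|apply: zint_conj; case: (OM i' j')].
have ME i j i' j' : M i j * (M i' j')^*%C = r * (M i j / l * (M i' j' / l)^*%C).
  have lJ0 : l^*%C != 0 by rewrite conjc_eq0.
  by rewrite /r rmorphM fmorphV /=; field; rewrite l0 lJ0.
have Ltr i j i' j' : L (M i j * (M i' j')^*%C + M i' j' * (M i j)^*%C).
  split; last by apply: integral_add; exact: zM.
  have [t tE] := imquad_trace m_gt0 (imquadM (KM i j) (imquad_conj m_gt0 (KM i' j'))).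
  exists t; rewrite -tE mulrDr -ME; congr (_ + _).
  by rewrite ME; congr (_ * _); rewrite [RHS]rmorphM /= conjcK mulrC.
have Lnm i j : L (M i j * (M i j)^*%C).
  split; last exact: zM.
  have [t tE] := imquad_norm m_gt0 (KM i j).
  by exists t; rewrite -tE ME.
have LB y z (k : int) : L y -> L z -> L (y - k%:~R * z).
  move=> [[t ->] iy] [[t' ->] iz]; split.
    by exists (t - k%:~R * t'); rewrite rmorphB rmorphM /= ratr_int; ring.
  by apply: integral_sub => //; apply: integral_mul => //; case: (oint_int R m k).
have [i0 [j0 M0]] : exists i j, M i j != 0.
  apply: contrapT => h; have M00 i j : M i j = 0.
    by apply/eqP; apply: contrapT => /negP ?; apply: h; exists i, j.
  by move/eqP: detM; rewrite !M00 !mul0r subrr eq_sym oner_eq0.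
pose P n := `[< (0 < n)%N /\ exists2 y, L y & y ^+ 2 = n%:R >].
have exP : exists n, P n.
  have [n nE] := Lsq _ (Lnm i0 j0); exists n; apply/asboolP; split.
    rewrite lt0n -(pnatr_eq0 C) -nE sqrf_eq0 mulf_neq0 // conjc_eq0 //.
  by exists (M i0 j0 * (M i0 j0)^*%C).
case: (ex_minnP exP) => N /asboolP[N0 [rho Lrho rhoE]] Nmin.
have rho0 : rho != 0 by rewrite -sqrf_eq0 rhoE pnatr_eq0 -lt0n.
have [t0 t0E] : exists t, rho = r * ratr t by case: Lrho.
have t00 : t0 != 0 by apply: contraNneq rho0 => t00; rewrite t0E t00 rmorph0 mulr0.
have t00C : (ratr t0 : C) != 0 by rewrite fmorph_eq0.
(* Division with remainder: the remainder of [y] by [rho] has a square below [N], so it is 0. *)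
have Lrho_mul y : L y -> exists k : int, y / rho = k%:~R.
  move=> Ly; have [[t tE] _] := Ly; pose k := Num.floor (t / t0); exists k.
  have ut : y = ratr (t / t0) * rho.
    by rewrite tE t0E fmorph_div /=; field.
  have Lz := LB y rho k Ly Lrho; have [n nE] := Lsq _ Lz.
  have [n0|n0] := posnP n.
    move/eqP: nE; rewrite n0 sqrf_eq0 subr_eq0 => /eqP ->.
    by rewrite mulfK.
  have : (N <= n)%N by apply: Nmin; apply/asboolP; split=> //; exists (y - k%:~R * rho).
  suff : (n < N)%N by rewrite ltnNge => /negPf ->.
  have /andP[k1 k2] := floor_itv (t / t0).
  have : (n%:R : rat) < N%:R.
    have -> : (n%:R : rat) = (t / t0 - k%:~R) ^+ 2 * N%:R.
      apply: (fmorph_inj (ratr : {rmorphism rat -> C})).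
      rewrite rmorphM rmorphXn rmorphB /= !ratr_nat ratr_int -nE -rhoE {1}ut.
      by ring.
    rewrite gtr_pMl ?ltr0n // expr_lt1 //.
      by rewrite ltrBlDr addrC -[1]/(1%:~R) -rmorphD.
    by rewrite subr_ge0.
  by rewrite ltr_nat.
have rhoJ := LJ _ Lrho.
(* The trace and the norm of the quotient are rational integers by [Lrho_mul]. *)
have Orho i j i' j' : O (M i j * (M i' j')^*%C / rho).
  have [s sE] := Lrho_mul _ (Ltr i j i' j').
  have [s1 s1E] := Lrho_mul _ (Lnm i j).
  have [s2 s2E] := Lrho_mul _ (Lnm i' j').
  apply: (@oint_trace_norm R m _ s (s1 * s2)).
  - have -> : M i j * (M i' j')^*%C / rho = M i j / l * (M i' j' / l)^*%C / ratr t0.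
      by rewrite ME t0E invfM mulrACA mulfV ?mul1r.
    apply: imquad_div; last exact: imquad_rat.
    exact/imquadM/imquad_conj.
  - rewrite -sE !rmorphM fmorphV /= rhoJ conjcK; ring.
  - by rewrite [RHS]rmorphM /= -s1E -s2E !rmorphM fmorphV /= rhoJ conjcK; ring.
have N1 : N = 1%N.
  (* [1 / rho ^+ 2] is [det M] times its conjugate over [rho ^+ 2], which expands into products of
     quotients from [Orho]. *)
  have : O (ratr (N%:R^-1)).
    rewrite fmorphV /= ratr_nat -rhoE.
    have -> : (rho ^+ 2)^-1 = M 0 0 * (M 0 0)^*%C / rho * (M 1 1 * (M 1 1)^*%C / rho)
      - M 0 0 * (M 0 1)^*%C / rho * (M 1 1 * (M 1 0)^*%C / rho)
      - M 0 1 * (M 0 0)^*%C / rho * (M 1 0 * (M 1 1)^*%C / rho)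
      + M 0 1 * (M 0 1)^*%C / rho * (M 1 0 * (M 1 0)^*%C / rho).
      have detJ := congr1 conjc detM; rewrite rmorphB !rmorphM rmorph1 /= in detJ.
      transitivity ((M 0 0 * M 1 1 - M 0 1 * M 1 0) * ((M 0 0)^*%C * (M 1 1)^*%C
        - (M 0 1)^*%C * (M 1 0)^*%C) / rho ^+ 2); first by rewrite detM detJ !mul1r.
      by field.
    by apply: ointD; [apply: ointB; [apply: ointB|]|]; apply: ointM.
  move=> /oint_rat[k kE].
  have N0' : N%:R != 0 :> rat by rewrite pnatr_eq0 -lt0n.
  have : (N%:Z * k)%:~R = 1 :> rat by rewrite rmorphM /= -kE mulfV.
  move=> /(@intr_inj rat _ 1) h.
  have : (N %| 1)%N.
    have : (N%:Z %| 1)%Z by apply/dvdzP; exists k; rewrite mulrC h.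
    by [].
  by rewrite dvdn1 => /eqP.
move=> i j i' j'; have /eqP : rho ^+ 2 = 1 by rewrite rhoE N1.
rewrite sqrf_eq1 => /orP[] /eqP rho1; have := Orho i j i' j'; rewrite rho1.
  by rewrite divr1.
by rewrite invrN1 mulrN1 => /ointN; rewrite opprK.
Qed.

End ConjugateProducts.

(** * Computation with explicit two by two matrices *)

Section TwoByTwo.
Variable F : comUnitRingType.
Implicit Types (a b c d : F) (M N : 'M[F]_2).

Definition mx2 a b c d : 'M[F]_2 :=
  \matrix_(i, j) if i == 0 then if j == 0 then a else b else if j == 0 then c else d.

Lemma mx2P M N :
  M 0 0 = N 0 0 -> M 0 1 = N 0 1 -> M 1 0 = N 1 0 -> M 1 1 = N 1 1 -> M = N.
Proof.
move=> h00 h01 h10 h11; apply/matrixP => i j.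
by case: (ord2E i) => ->; case: (ord2E j) => ->.
Qed.

Lemma mx2_eta M : mx2 (M 0 0) (M 0 1) (M 1 0) (M 1 1) = M.
Proof. by apply: mx2P; rewrite mxE. Qed.

Lemma sum_ord2 (f : 'I_2 -> F) : \sum_k f k = f 0 + f 1.
Proof. by rewrite big_ord_recl big_ord1; congr (_ + f _); exact: val_inj. Qed.

Lemma mulmx2 a b c d a' b' c' d' : mx2 a b c d *m mx2 a' b' c' d' =
  mx2 (a * a' + b * c') (a * b' + b * d') (c * a' + d * c') (c * b' + d * d').
Proof. by apply: mx2P; rewrite !mxE sum_ord2 !mxE. Qed.

Lemma det2E M : \det M = M 0 0 * M 1 1 - M 0 1 * M 1 0.
Proof.
rewrite (expand_det_row _ 0) sum_ord2 /cofactor !det_mx11 !mxE /=.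
rewrite !addn0 !expr0 !mul1r /= expr1 mulN1r mulrN; congr (_ * M _ _ - _ * M _ _);
  exact: val_inj.
Qed.

Lemma det_mx2 a b c d : \det (mx2 a b c d) = a * d - b * c.
Proof. by rewrite det2E !mxE. Qed.

Lemma mx2_1 : mx2 1 0 0 1 = 1%:M.
Proof. by apply: mx2P; rewrite !mxE. Qed.

Lemma invmx2 a b c d : a * d - b * c = 1 -> invmx (mx2 a b c d) = mx2 d (- b) (- c) a.
Proof.
move=> D; have u : mx2 a b c d \in unitmx by rewrite unitmxE det_mx2 D unitr1.
rewrite -[RHS]mul1mx -(mulVmx u) -mulmxA mulmx2.
suff -> : mx2 (a * d + b * - c) (a * - b + b * a) (c * d + d * - c) (c * - b + d * a) = 1%:M.
  by rewrite mulmx1.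
by rewrite -mx2_1; congr mx2; rewrite -?D; ring.
Qed.

End TwoByTwo.

(** * Discreteness of matrix groups *)

(** Balls of matrices are taken entrywise. The radius lives in [C], where being positive includes
    being real. *)
Lemma discrete_setP (C : numFieldType) (G : set 'M[C]_2) : discrete_set G <->
  forall M, G M -> exists2 e : C, 0 < e &
    forall N, G N -> (forall i j, `|M i j - N i j| < e) -> N = M.
Proof.
split=> [dG M GM|dG M GM].
  have [_ [V /nbhs_ballP[e e0 hV] VG]] := dG _ GM; exists e => // N GN hN.
  suff : (V `&` G) N by rewrite VG.
  by split=> //; apply: hV; split.
split; first exact/mem_set.
have [e e0 he] := dG _ GM; exists (ball M e); first by apply/nbhs_ballP; exists e.
apply/seteqP; split=> [N [[_ hN] GN]|_ ->]; last by split=> //; exact: ballxx.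
by apply: he => // i j; exact: hN.
Qed.

Section DiscreteSets.
Variable R : realType.
Local Notation C := R[i].
Local Notation nm := (@Normc.normc R).
Implicit Types (G : set 'M[C]_2) (M : 'M[C]_2).

Definition isolated_at1 G := exists2 e : R, 0 < e &
  forall M, G M -> (forall i j, nm (M i j - (1%:M : 'M[C]_2) i j) < e) -> M = 1%:M.

Lemma complex_gt0 (e : C) : 0 < e -> exists2 x : R, 0 < x & e = x%:C.
Proof.
by move=> e0; have := e0; rewrite ltcE /= => /andP[_ h]; exists (complex.Re e) => //;
  rewrite RRe_real // ger0_real // ltW.
Qed.

Lemma discrete_isolated_at1 G : discrete_set G -> G 1%:M -> isolated_at1 G.
Proof.
move=> /discrete_setP dG /dG[_ /complex_gt0[e e0 ->] he].
exists e => // M GM hM; apply: he => // i j.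
by rewrite -nmE ltcR -nmN opprB.
Qed.

Lemma SL2_unitmx M : SL2 M -> M \in unitmx.
Proof. by rewrite /SL2 /= unitmxE => ->; rewrite unitr1. Qed.

(** Translation by the inverse of [M0] carries a neighbour of [M0] to a neighbour of 1, with a loss
    controlled by the entries of that inverse. *)
Lemma isolated_at1_discrete G : SL2_subgroup G -> isolated_at1 G -> discrete_set G.
Proof.
move=> [GS G1 GM GV] [e e0 he]; apply/discrete_setP => M0 G0.
have M0u := SL2_unitmx (GS _ G0).
pose B := 1 + \sum_i \sum_j nm (invmx M0 i j).
have B_ge i j : nm (invmx M0 i j) <= B.
  have := nm_ge0 (invmx M0 0 0); have := nm_ge0 (invmx M0 0 1).
  have := nm_ge0 (invmx M0 1 0); have := nm_ge0 (invmx M0 1 1).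
  by rewrite /B !sum_ord2; case: (ord2E i) => ->; case: (ord2E j) => ->; lra.
have B0 : 0 < B.
  by rewrite /B ltr_pwDl // sumr_ge0 // => *; rewrite sumr_ge0 // => *; exact: nm_ge0.
pose d := e / (2 * B).
have d0 : 0 < d by rewrite divr_gt0 // mulr_gt0.
exists d%:C; first by rewrite ltcR.
move=> M GM' hM.
suff M1 : M *m invmx M0 = 1%:M by rewrite -[M]mulmx1 -(mulVmx M0u) mulmxA M1 mul1mx.
apply: he; first by apply: GM => //; exact: GV.
move=> i j; rewrite -(mulmxV M0u) -[X in nm (X - _)]/((M *m invmx M0) i j).
have -> : (M *m invmx M0) i j - (M0 *m invmx M0) i j =
    - \sum_k (M0 i k - M i k) * invmx M0 k j.
  rewrite !mxE -sumrB -sumrN; apply: eq_bigr => k _; ring.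
rewrite nmN sum_ord2; apply: le_lt_trans (nmD _ _) _; rewrite !nmM.
have t k : nm (M0 i k - M i k) * nm (invmx M0 k j) < d * B.
  apply: (@le_lt_trans _ _ (nm (M0 i k - M i k) * B)).
    by rewrite ler_wpM2l // nm_ge0.
  by rewrite ltr_pM2r // -ltcR nmE.
apply: lt_le_trans (ltrD (t 0) (t 1)) _.
by rewrite le_eqVlt; apply/orP; left; apply/eqP; rewrite /d; field; exact: lt0r_neq0.
Qed.

End DiscreteSets.

(** * The action of [SL_2(C)] on hermitian matrices *)

Section Hermitian.
Variable R : realType.
Local Notation C := R[i].

Lemma hermx_subproof (x y : R) (z : C) : mx2 x%:C z z^*%C y%:C \in @hermitian2 R.
Proof.
apply/hermitian2P; apply: mx2P; rewrite !mxE //=.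
- by rewrite [RHS]conjc_real.
- by rewrite -[RHS]/(conjc (conjc z)) conjcK.
- by rewrite [RHS]conjc_real.
Qed.

Definition hermx (x y : R) (z : C) : herm R := Herm (hermx_subproof x y z).

Lemma phi1 : phi (1%:M : 'M[C]_2) = \1%VF.
Proof.
apply/lfunP => H; apply/val_inj; rewrite id_lfunE /= phiE mul1mx.
rewrite -[RHS]mulmx1; congr (_ *m _).
by apply: mx2P; rewrite !mxE /= ?rmorph1 ?rmorph0.
Qed.

Lemma phiM (M N : 'M[C]_2) : phi (M *m N) = (phi M \o phi N)%VF.
Proof.
apply/lfunP => H; apply/val_inj; rewrite comp_lfunE /= !phiE.
by rewrite trmx_mul map_mxM !mulmxA.
Qed.

Lemma phiVK (M : 'M[C]_2) H : SL2 M -> phi (invmx M) (phi M H) = H.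
Proof. by move=> /SL2_unitmx u; rewrite -comp_lfunE -phiM mulVmx // phi1 id_lfunE. Qed.

Lemma phiKV (M : 'M[C]_2) H : SL2 M -> phi M (phi (invmx M) H) = H.
Proof. by move=> /SL2_unitmx u; rewrite -comp_lfunE -phiM mulmxV // phi1 id_lfunE. Qed.

Lemma SL2M (M N : 'M[C]_2) : SL2 M -> SL2 N -> SL2 (M *m N).
Proof. by rewrite /SL2 /= det_mulmx => -> ->; rewrite mulr1. Qed.

Lemma SL2V (M : 'M[C]_2) : SL2 M -> SL2 (invmx M).
Proof. by rewrite /SL2 /= det_inv => ->; rewrite invr1. Qed.

Lemma phi_entry (M : 'M[C]_2) (H : herm R) i j : phi M H i j =
  \sum_l \sum_k M i k * (H : 'M[C]_2) k l * (M j l)^*%C.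
Proof.
by rewrite phiE !mxE; apply: eq_bigr => l _; rewrite !mxE mulr_suml.
Qed.

Lemma herm_entryJ (H : herm R) i j : (H : 'M[C]_2) i j = ((H : 'M[C]_2) j i)^*%C.
Proof. by rewrite {1}(hermP H) !mxE. Qed.

End Hermitian.

(** * The lattice stabilizer as the largest discrete extension *)

Section LatticeStabilizer.
Variables (R : realType) (m : nat).
Hypothesis m_gt0 : (0 < m)%N.
Local Notation C := R[i].
Local Notation O := (@imquad_int C m).
Local Notation nm := (@Normc.normc R).
Local Notation Lambda := (@LambdaK R m).
Implicit Types M N : 'M[C]_2.

(** The equivalence passes to products and inverses by rewriting; [lattice_stabilizerP] gives the
    form with images. *)
Definition lattice_stabilizer : set 'M[C]_2 :=
  [set M | SL2 M /\ forall H, Lambda (phi M H) <-> Lambda H].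
Local Notation St := lattice_stabilizer.

Lemma lattice_stabilizerP M :
  St M <-> SL2 M /\ phi M @` Lambda = Lambda.
Proof.
split=> [[sM hM]|[sM hM]]; split=> //.
  apply/seteqP; split=> [_ [H LH <-]|H LH]; first exact/hM.
  exists (phi (invmx M) H); last exact: phiKV.
  by apply/hM; rewrite phiKV.
move=> H; split=> [|LH]; last by rewrite -hM; exists H.
by rewrite -{1}hM => -[H' LH' E]; rewrite -(phiVK H sM) -E phiVK.
Qed.

Lemma oint_sum (f : 'I_2 -> C) : (forall k, O (f k)) -> O (\sum_k f k).
Proof. by move=> Of; rewrite sum_ord2; exact: ointD. Qed.

Lemma phi_lattice M H : (forall i j i' j', O (M i j * (M i' j')^*%C)) ->
  Lambda H -> Lambda (phi M H).
Proof.
move=> OM LH i j; rewrite phi_entry; apply: oint_sum => l; apply: oint_sum => k.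
by rewrite mulrAC; apply: ointM => //; exact: OM.
Qed.

Lemma stabilizer_subgroup : SL2_subgroup St.
Proof.
split=> [M []//| |M N [sM hM] [sN hN]|M [sM hM]].
- by split=> [|H]; [exact: det1|rewrite phi1 id_lfunE].
- by split=> [|H]; [exact: SL2M|rewrite phiM comp_lfunE hM hN].
- by split=> [|H]; [exact: SL2V|rewrite -hM phiKV].
Qed.

Lemma GammaK_inv M : GammaK m M -> GammaK m (invmx M).
Proof.
move=> [sM OM]; split; first exact: SL2V.
have D : M 0 0 * M 1 1 - M 0 1 * M 1 0 = 1 by rewrite -det2E.
rewrite -[M]mx2_eta invmx2 // => i j; rewrite mxE.
by case: ifP => _; case: ifP => _ //; exact: ointN.
Qed.

Lemma GammaK_stabilizer : GammaK m `<=` St.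
Proof.
have h M H : GammaK m M -> Lambda H -> Lambda (phi M H).
  move=> [_ OM]; apply: phi_lattice => i j i' j'.
  exact/ointM/oint_conj.
move=> M GM; have [sM _] := GM; split=> // H; split=> [LH|]; last exact: h.
by rewrite -(phiVK H sM); apply: h => //; exact: GammaK_inv.
Qed.

Lemma hermx_lattice (x y : int) (z : C) : O z -> Lambda (hermx x%:~R y%:~R z).
Proof.
move=> Oz i j; have Oint (k : int) : O ((k%:~R : R)%:C).
  by rewrite rmorph_int; exact: oint_int.
case: (ord2E i) => ->; case: (ord2E j) => ->; rewrite /= mxE //=.
by exact: oint_conj.
Qed.

Lemma oint_near x y : O x -> O y -> nm (x - y) < 1 -> x = y.
Proof.
by move=> Ox Oy h; apply/eqP; rewrite -subr_eq0; apply/eqP/(oint_small m_gt0)/h/ointB.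
Qed.

(** The images of three lattice elements show that [a a^*], [b b^*], [c c^*], [d d^*] and
    [a d^* + b c^*] are in [O]. Near the identity they take their values at the identity, so
    [b = c = 0] and [a d^* = 1 = a d]. Thus [d] is real, [d = 1] or [d = -1], and the latter is too
    far from 1. *)
Lemma stabilizer_isolated_at1 : isolated_at1 St.
Proof.
exists (4^-1); first by rewrite invr_gt0.
move=> M [sM hM] near1; have D : M 0 0 * M 1 1 - M 0 1 * M 1 0 = 1 by rewrite -det2E.
have ent x y z i j : O z -> O (phi M (hermx (x%:~R) (y%:~R) z) i j).
  by move=> Oz; have := (hM _).2 (hermx_lattice x y Oz); exact.
have := near1 0 0; have := near1 0 1; have := near1 1 0; have := near1 1 1.
rewrite !mxE /= !subr0 => hd hc hb ha.
have := ent 1 0 0 0 0 (oint0 _ _); have := ent 1 0 0 1 1 (oint0 _ _).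
have := ent 0 1 0 0 0 (oint0 _ _); have := ent 0 1 0 1 1 (oint0 _ _).
have := ent 0 0 1 0 1 (oint1 _ _).
rewrite !phi_entry !sum_ord2 !mxE ?conjc0 ?conjc1 /= ?rmorph0 ?rmorph1.
rewrite !(mulr0, mul0r, mulr1, addr0, add0r) -[M in M = _]mx2_eta.
move: (M 0 0) (M 0 1) (M 1 0) (M 1 1) D hd hc hb ha => a b c d D hd hc hb ha.
have small x : nm x < 4^-1 -> O (x * x^*%C) -> x = 0.
  move=> hx /(oint_small m_gt0) h; apply/eqP.
  suff : x * x^*%C == 0 by rewrite mulf_eq0 conjc_eq0 orbb.
  by apply/eqP/h; rewrite nmM nmJ; have := nm_ge0 x; nra.
have near x y : nm (x - 1) < 4^-1 -> nm (y - 1) < 4^-1 -> O (x * y^*%C) -> x * y^*%C = 1.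
  move=> hx hy Oxy; apply: oint_near => //; first exact: oint1.
  have -> : x * y^*%C - 1 = (x - 1) * (y - 1)^*%C + ((x - 1) + (y - 1)^*%C).
    by rewrite rmorphB rmorph1 /=; ring.
  apply: le_lt_trans (nmD _ _) _; have := nmD (x - 1) (y - 1)^*%C.
  by rewrite nmM nmJ; have := nm_ge0 (x - 1); have := nm_ge0 (y - 1); nra.
move=> Oad Odd Obb Occ Oaa.
have b0 : b = 0 by exact: small.
have c0 : c = 0 by exact: small.
have dd : d * d^*%C = 1 by exact: near.
have ad : a * d^*%C = 1 by apply: near => //; move: Oad; rewrite b0 mul0r add0r.
move: D; rewrite b0 mul0r subr0 => D.
have a0 : a != 0 by apply: contra_eq_neq D => ->; rewrite mul0r eq_sym oner_neq0.
have dJ : d^*%C = d by apply: (mulfI a0); rewrite ad D.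
move/eqP: dd; rewrite dJ -expr2 sqrf_eq1 => /orP[] /eqP d1; last first.
  move: hd; rewrite d1 -opprD nmN.
  have -> : nm (1 + 1) = 2 by rewrite -[1 + 1]/(2%:R) -(rmorph_nat (real_complex R)) nmR ger0_norm.
  by move=> h; exfalso; lra.
by move: D; rewrite d1 mulr1 c0 => ->; rewrite mx2_1.
Qed.

Lemma stabilizer_discrete_extension : discrete_extension (GammaK m) St.
Proof.
split; [exact: stabilizer_subgroup|exact: GammaK_stabilizer|].
exact: isolated_at1_discrete stabilizer_subgroup stabilizer_isolated_at1.
Qed.

Lemma discrete_extension_stabilizer (G : set 'M[C]_2) :
  discrete_extension (GammaK m) G -> G `<=` St.
Proof.
move=> [[GS G1 GM GV] GammaG /discrete_isolated_at1 /(_ G1) [e e0 he]].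
pose g a b c d := G (mx2 a b c d).
have gM a b c d a' b' c' d' : g a b c d -> g a' b' c' d' ->
  g (a * a' + b * c') (a * b' + b * d') (c * a' + d * c') (c * b' + d * d').
  by move=> h h'; rewrite /g -mulmx2; exact: GM.
have g_det a b c d : g a b c d -> a * d - b * c = 1.
  by move=> /GS; rewrite /SL2 /= det_mx2.
have gV a b c d : g a b c d -> g d (- b) (- c) a.
  by move=> h; rewrite /g -invmx2; [exact: GV|exact: g_det].
have gO a b c d : O a -> O b -> O c -> O d -> a * d - b * c = 1 -> g a b c d.
  move=> Oa Ob Oc Od D; apply: GammaG; split; first by rewrite /SL2 /= det_mx2.
  by move=> i j; rewrite mxE; case: ifP => _; case: ifP.
have g_disc : exists2 e : R, 0 < e & forall a b c d, g a b c d ->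
    nm (a - 1) < e -> nm b < e -> nm c < e -> nm (d - 1) < e ->
    [/\ a = 1, b = 0, c = 0 & d = 1].
  exists e => // a b c d gM0 ha hb hc hd.
  have E : mx2 a b c d = 1%:M.
    apply: he => // i j; case: (ord2E i) => ->; case: (ord2E j) => ->;
    by rewrite !mxE //= subr0.
  have Eij i j : mx2 a b c d i j = (1%:M : 'M[C]_2) i j by rewrite E.
  by have := (Eij 0 0, Eij 0 1, Eij 1 0, Eij 1 1); rewrite !mxE /= => -[[[]]].
have h M H : G M -> Lambda H -> Lambda (phi M H).
  move=> gM0; apply: phi_lattice; have gM1 : g (M 0 0) (M 0 1) (M 1 0) (M 1 1).
    by rewrite /g mx2_eta.
  have [l [l0 Kl Ka Kb [Kc Kd]]] := g_rational_form m_gt0 gM gV g_det gO g_disc gM1.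
  have [Oa Ob Oc Od] := g_entry_sqr m_gt0 gM gV g_det gO g_disc gM1.
  apply: (@entry_conj_products R m m_gt0 l) => //.
  - by move=> i j; case: (ord2E i) => ->; case: (ord2E j) => ->.
  - by move=> i j; case: (ord2E i) => ->; case: (ord2E j) => ->.
  - exact: g_det.
move=> M gM0; have sM := GS _ gM0; split=> // H; split=> [LH|]; last exact: h.
by rewrite -(phiVK H sM); apply: h => //; exact: GV.
Qed.

Lemma maximal_discrete_extension_stabilizer (G : set 'M[C]_2) :
  maximal_discrete_extension (GammaK m) G -> G = St.
Proof.
move=> [dG maxG]; symmetry; apply: maxG; first exact: stabilizer_discrete_extension.
exact: discrete_extension_stabilizer.
Qed.

End LatticeStabilizer.

(** * Determinants of endomorphisms *)

(** The block matrix with rows [(1, u)] and [(c, 1)] is factored into triangular ones in two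
    ways. *)
Lemma det_rank1_update (F : fieldType) n (c : 'cV[F]_n) (u : 'rV[F]_n) :
  \det (1%:M - c *m u) = 1 - (u *m c) 0 0.
Proof.
have E1 : block_mx 1%:M u c 1%:M =
    block_mx (1%:M : 'M[F]_1) 0 c 1%:M *m block_mx 1%:M u 0 (1%:M - c *m u).
  by rewrite mulmx_block !mul1mx !mul0mx !mulmx1 !addr0 addrC subrK.
have E2 : block_mx 1%:M u c 1%:M =
    block_mx (1%:M - u *m c) u 0 1%:M *m block_mx (1%:M : 'M[F]_1) 0 c 1%:M.
  by rewrite mulmx_block !mul0mx !mulmx1 !mulmx0 !add0r subrK mul1mx.
have := congr1 (fun A => \det A) E1.
rewrite E2 !det_mulmx !det_lblock !det_ublock !det1 !mul1r !mulr1 => <-.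
by rewrite det_mx11 !mxE.
Qed.

Section EndoDet.
Variables (F : fieldType) (V : vectType F).
Implicit Types f h : 'End(V).

Lemma endo_det1 : endo_det (\1%VF : 'End(V)) = 1.
Proof. by rewrite /endo_det passmx.mxof1 ?det1 // (basis_free (vbasisP _)). Qed.

Lemma endo_detM f h : endo_det (f \o h)%VF = endo_det f * endo_det h.
Proof.
by rewrite /endo_det (passmx.mxof_comp _ _ (vbasisP _)) det_mulmx mulrC.
Qed.

(** In any basis the matrix is the identity minus a column (values of [lam]) times a row
    (coordinates of [v]). This evaluates a reflection with no explicit basis. *)
Lemma endo_det_rank1_update f (v : V) (lam : {scalar V}) :
  (forall x, f x = x - lam x *: v) -> endo_det f = 1 - lam v.
Proof.
move=> fE; set e := vbasis {:V}; have eb : basis_of {:V} e := vbasisP _.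
pose c : 'cV[F]_(\dim {:V}) := \col_i lam e`_i.
have fM : passmx.mxof e e f = 1%:M - c *m passmx.rVof e v.
  apply/matrixP => i j; rewrite !mxE /= passmx.vecof_delta fE linearB linearZ /=.
  by rewrite coord_free ?(basis_free eb) // big_ord1 !mxE eq_sym.
rewrite /endo_det fM det_rank1_update; congr (1 - _).
rewrite mxE [in RHS](coord_basis eb (memvf v)) linear_sum.
by apply: eq_bigr => i _; rewrite !mxE linearZ.
Qed.

End EndoDet.

(** * The image of [SL_2(C)] lies in [SO_0(V, q)] *)

Section PhiDeterminant.
Variable R : realType.
Local Notation C := R[i].
Implicit Types M N : 'M[C]_2.
Local Notation dphi M := (endo_det (phi M)).

Lemma dphiM M N : dphi (M *m N) = dphi M * dphi N.
Proof. by rewrite phiM endo_detM. Qed.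

Lemma dphi1 : dphi (1%:M : 'M[C]_2) = 1.
Proof. by rewrite phi1 endo_det1. Qed.

(* T_x is the commutator of diag(2, 1/2) and T_(x/3). *)
Lemma dphi_upper (x : C) : dphi (mx2 1 x 0 1) = 1.
Proof.
pose y := x / 3; pose D : 'M[C]_2 := mx2 2 0 0 2^-1; pose D' : 'M[C]_2 := mx2 2^-1 0 0 2.
have two0 : (2 : C) != 0 by rewrite pnatr_eq0.
have three0 : (3 : C) != 0 by rewrite pnatr_eq0.
have -> : mx2 1 x 0 1 = D *m mx2 1 y 0 1 *m D' *m mx2 1 (- y) 0 1.
  by rewrite !mulmx2 /y; congr mx2; field.
have DD : dphi D * dphi D' = 1.
  have E : D *m D' = 1%:M by rewrite mulmx2 -mx2_1; congr mx2; field.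
  by rewrite -dphiM E dphi1.
have TT : dphi (mx2 1 y 0 1) * dphi (mx2 1 (- y) 0 1) = 1.
  have E : mx2 1 y 0 1 *m mx2 1 (- y) 0 1 = 1%:M.
    by rewrite mulmx2 -mx2_1; congr mx2; ring.
  by rewrite -dphiM E dphi1.
by rewrite !dphiM [dphi D * _ * dphi D']mulrAC DD mul1r TT.
Qed.

Lemma dphi_lower (x : C) : dphi (mx2 1 0 x 1) = 1.
Proof.
pose W : 'M[C]_2 := mx2 0 (- 1) 1 0; pose W' : 'M[C]_2 := mx2 0 1 (- 1) 0.
have -> : mx2 1 0 x 1 = W *m mx2 1 (- x) 0 1 *m W'.
  by rewrite !mulmx2; congr mx2; ring.
have WW : dphi W * dphi W' = 1.
  have E : W *m W' = 1%:M by rewrite mulmx2 -mx2_1; congr mx2; ring.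
  by rewrite -dphiM E dphi1.
by rewrite !dphiM dphi_upper mulr1 WW.
Qed.

(** [SL_2(C)] is generated by unipotents: for [c != 0] a matrix is upper times lower times upper,
    and a lower unipotent factor reduces [c = 0] to this case. *)
Lemma dphi_SL2 M : SL2 M -> dphi M = 1.
Proof.
have main (a b c d : C) : a * d - b * c = 1 -> c != 0 -> dphi (mx2 a b c d) = 1.
  move=> D c0.
  have -> : mx2 a b c d = mx2 1 ((a - 1) / c) 0 1 *m mx2 1 0 c 1 *m mx2 1 ((d - 1) / c) 0 1.
    have bE : b = (a * d - 1) / c by rewrite -D; field.
    by rewrite !mulmx2 bE; congr mx2; field.
  by rewrite !dphiM !dphi_upper dphi_lower !mulr1.
rewrite /SL2 /= det2E => D; rewrite -[M]mx2_eta.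
have [c0|c0] := eqVneq (M 1 0) 0; last exact: main.
have a0 : M 0 0 != 0.
  by apply: contra_eq_neq D => ->; rewrite c0 mul0r mulr0 subr0 eq_sym oner_neq0.
suff : dphi (mx2 1 0 1 1 *m mx2 (M 0 0) (M 0 1) (M 1 0) (M 1 1)) = 1.
  by rewrite dphiM dphi_lower mul1r.
rewrite mulmx2 !(mul1r, mul0r, addr0) c0 addr0.
by apply: main => //; rewrite -D c0; ring.
Qed.

Lemma phi_q M H : SL2 M -> herm_q (phi M H) = herm_q H.
Proof.
move=> sM; apply: (@complexI R); rewrite !herm_qE phiE !det_mulmx.
rewrite -[X in _ * _ * X](_ : (\det M)^*%C = _); last first.
  rewrite -[LHS]/(Num.conj _) -det_map_mx -det_tr; congr (\det _).
  by apply/matrixP => i j; rewrite !mxE.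
by rewrite sM conjc1 mulr1 mul1r.
Qed.

Lemma phi_SO M : SL2 M -> SO_herm (phi M).
Proof. by move=> sM; split=> [H|]; [exact: phi_q|exact: dphi_SL2]. Qed.

(** The trace of [M M^*] is the sum of the squared moduli of the entries of [M]. *)
Lemma phi_SO0 M : SL2 M -> SO0_herm (phi M).
Proof.
move=> sM; split; first exact: phi_SO.
rewrite /mxtrace sum_ord2 !phi_entry !sum_ord2 /= !mxE /=.
rewrite !(mulr0, mul0r, mulr1, addr0, add0r).
have nn (z : C) : 0 <= z * z^*%C by exact: mulcJ_ge0.
rewrite lt_def !addr_ge0 ?nn // andbT; apply/negP => /eqP h.
have z0 (z : C) : z * z^*%C = 0 -> z = 0.
  by move=> /eqP; rewrite mulf_eq0 conjc_eq0 orbb => /eqP.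
move/eqP: h; rewrite !paddr_eq0 ?addr_ge0 ?nn //.
move=> /andP[/andP[/eqP/z0 h00 /eqP/z0 h01] /andP[/eqP/z0 h10 /eqP/z0 h11]].
by move: sM; rewrite /SL2 /= det2E h00 h10 mul0r mulr0 subr0 => /eqP; rewrite eq_sym oner_eq0.
Qed.

End PhiDeterminant.

(** * Surjectivity onto [SO_0(V, q)] *)

Section Surjectivity.
Variable R : realType.
Local Notation C := R[i].
Implicit Types (M N : 'M[C]_2) (f : 'End(herm R)) (H G : herm R).

(** [hermc 1 1 0 0] is the identity; [hermc 1 (-1) 0 0], [hermc 0 0 1 0] and [hermc 0 0 0 1] are the
    Pauli matrices sigma_3, sigma_1 and minus sigma_2. *)
Definition hermc (x y u v : R) : herm R := hermx x y (u +i* v).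

Lemma hermcE x y u v :
  (hermc x y u v : 'M[C]_2) = mx2 x%:C (u +i* v) (u -i* v) y%:C.
Proof. by []. Qed.

Lemma hermc_eta H : exists x y u v, H = hermc x y u v.
Proof.
have hd i : (H : 'M[C]_2) i i = (complex.Re ((H : 'M[C]_2) i i))%:C.
  have := herm_entryJ H i i; case: (herm_mx H i i) => x y /= [] yE.
  by have -> : y = 0 by lra.
exists (complex.Re ((H : 'M[C]_2) 0 0)), (complex.Re ((H : 'M[C]_2) 1 1)).
exists (complex.Re ((H : 'M[C]_2) 0 1)), (complex.Im ((H : 'M[C]_2) 0 1)).
apply/val_inj; rewrite /= -[LHS]mx2_eta; congr mx2; rewrite -?hd //.
  by case: (herm_mx H 0 1).
by rewrite (herm_entryJ H 1 0); case: (herm_mx H 0 1).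
Qed.

Lemma hermc_add x y u v x' y' u' v' :
  hermc x y u v + hermc x' y' u' v' = hermc (x + x') (y + y') (u + u') (v + v').
Proof.
apply/val_inj; rewrite /= -[LHS]mx2_eta; congr mx2; rewrite !mxE /= ?rmorphD //.
by apply/eqP; rewrite eq_complex /= opprD !eqxx.
Qed.

Lemma hermc_scale a x y u v : a *: hermc x y u v = hermc (a * x) (a * y) (a * u) (a * v).
Proof.
apply/val_inj; rewrite /= -[LHS]mx2_eta; congr mx2; rewrite !mxE /= ?rmorphM //;
  by apply/eqP; rewrite eq_complex /= ?mul0r ?subr0 ?addr0 ?mulrN !eqxx.
Qed.

Lemma herm1E : herm1 R = hermc 1 1 0 0.
Proof.
apply/val_inj; rewrite /= -[LHS]mx2_eta; congr mx2; rewrite !mxE //=.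
by rewrite /conjc oppr0.
Qed.

Lemma hermc_q x y u v : herm_q (hermc x y u v) = x * y - u ^+ 2 - v ^+ 2.
Proof. by rewrite /herm_q det2E hermcE !mxE /=; ring. Qed.

(** Polarization of [q], in coordinates, so that orthogonality to fixed vectors becomes linear
    equations. *)
Lemma polar_preserved f x y u v x' y' u' v' s t p q s' t' p' q' :
  (forall H, herm_q (f H) = herm_q H) ->
  f (hermc x y u v) = hermc s t p q -> f (hermc x' y' u' v') = hermc s' t' p' q' ->
  s * t' + s' * t - 2 * p * p' - 2 * q * q' = x * y' + x' * y - 2 * u * u' - 2 * v * v'.
Proof.
move=> fq E E'; have := fq (hermc x y u v + hermc x' y' u' v').
have := fq (hermc x y u v); have := fq (hermc x' y' u' v').
by rewrite linearD /= E E' !hermc_add !hermc_q; lra.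
Qed.

Lemma real_subi0 (x : R) : x -i* 0 = x%:C.
Proof. by rewrite oppr0. Qed.

Lemma phi_hermx (a b c d : C) x y z x' y' z' :
  (a * x%:C + b * z^*%C) * a^*%C + (a * z + b * y%:C) * b^*%C = x'%:C ->
  (a * x%:C + b * z^*%C) * c^*%C + (a * z + b * y%:C) * d^*%C = z' ->
  (c * x%:C + d * z^*%C) * c^*%C + (c * z + d * y%:C) * d^*%C = y'%:C ->
  phi (mx2 a b c d) (hermx x y z) = hermx x' y' z'.
Proof.
move=> h00 h01 h11; apply/val_inj; rewrite /= phiE.
have -> : (mx2 a b c d) ^t* = mx2 a^*%C c^*%C b^*%C d^*%C by apply: mx2P; rewrite !mxE.
rewrite !mulmx2 h00 h01 h11; congr mx2; rewrite -h01.
by rewrite !(rmorphD, rmorphM) /= !conjcK !real_subi0; ring.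
Qed.

Definition phi_image f := exists2 M, SL2 M & f = phi M.

Lemma SO_comp_phi M f : SL2 M -> SO_herm f -> SO_herm (phi M \o f)%VF.
Proof.
move=> sM [fq fd]; split=> [H|]; first by rewrite comp_lfunE phi_q.
by rewrite endo_detM fd dphi_SL2 // mulr1.
Qed.

Lemma phi_image_comp M f : SL2 M -> phi_image (phi (invmx M) \o f)%VF -> phi_image f.
Proof.
move=> sM [N sN E]; exists (M *m N); first exact: SL2M.
by rewrite phiM -E; apply/lfunP => H; rewrite !comp_lfunE phiKV.
Qed.

(** The factor 2 makes [H - im_form H *: hermc 0 0 0 1] the reflection that negates the last
    coordinate. *)
Definition im_form (H : herm R) : R := 2 * complex.Im ((H : 'M[C]_2) 0 1).

Lemma im_form_scalar : scalar im_form.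
Proof.
move=> a H G; have [x [y [u [v ->]]]] := hermc_eta H.
have [x' [y' [u' [v' ->]]]] := hermc_eta G.
by rewrite hermc_scale hermc_add /im_form !hermcE !mxE /=; ring.
Qed.

HB.instance Definition _ :=
  GRing.isLinear.Build R (herm R) R *%R im_form im_form_scalar.

(* Such an isometry fixes sigma_2 up to sign, and the sign is the determinant. *)
Lemma SO_fix3 f : SO_herm f -> f (hermc 1 1 0 0) = hermc 1 1 0 0 ->
  f (hermc 1 (-1) 0 0) = hermc 1 (-1) 0 0 -> f (hermc 0 0 1 0) = hermc 0 0 1 0 ->
  phi_image f.
Proof.
move=> [fq fd] f0 f3 f1; have [x [y [u [v f2]]]] := hermc_eta (f (hermc 0 0 0 1)).
have h0 := polar_preserved fq f2 f0; have h3 := polar_preserved fq f2 f3.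
have h1 := polar_preserved fq f2 f1; have h2 := polar_preserved fq f2 f2.
have [x0 y0 u0] : [/\ x = 0, y = 0 & u = 0] by split; lra.
have fE a b p q : f (hermc a b p q) = hermc a b p (q * v).
  have -> : hermc a b p q = ((a + b) / 2) *: hermc 1 1 0 0 + ((a - b) / 2) *: hermc 1 (-1) 0 0
     + p *: hermc 0 0 1 0 + q *: hermc 0 0 0 1.
    by rewrite !hermc_scale !hermc_add; congr hermc; field.
  rewrite !linearD !linearZ /= f0 f3 f1 f2 x0 y0 u0.
  by rewrite !hermc_scale !hermc_add; congr hermc; field.
have /eqP : v ^+ 2 = 1 by rewrite x0 y0 u0 in h2; rewrite expr2; lra.
rewrite sqrf_eq1 => /orP[] /eqP v1.
  exists 1%:M; first exact: det1.
  apply/lfunP => H; have [a [b [p [q ->]]]] := hermc_eta H.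
  by rewrite fE v1 mulr1 phi1 id_lfunE.
have imE a b p q : im_form (hermc a b p q) = 2 * q by rewrite /im_form hermcE mxE.
have h : (forall H, f H = H - im_form H *: hermc 0 0 0 1) ->
  endo_det f = 1 - im_form (hermc 0 0 0 1) by exact: endo_det_rank1_update.
rewrite fd imE mulr1 in h.
have : 1 = 1 - 2 :> R.
  apply: h => H; have [a [b [p [q ->]]]] := hermc_eta H.
  rewrite fE v1 imE -scaleNr hermc_scale hermc_add.
  by congr hermc; ring.
by lra.
Qed.

(** The image of sigma_1 is orthogonal to the two fixed matrices, hence [hermc 0 0 u v] with
    [u + i v] on the unit circle. For a square root [z] of [u + i v], the diagonal matrix of [z] and
    [z^*] rotates sigma_1 there and fixes the other two. *)
Lemma SO_fix2 f : SO_herm f -> f (hermc 1 1 0 0) = hermc 1 1 0 0 ->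
  f (hermc 1 (-1) 0 0) = hermc 1 (-1) 0 0 -> phi_image f.
Proof.
move=> SOf f0 f3; have [fq _] := SOf.
have [x [y [u [v f1]]]] := hermc_eta (f (hermc 0 0 1 0)).
have h0 := polar_preserved fq f1 f0; have h3 := polar_preserved fq f1 f3.
have h1 := polar_preserved fq f1 f1.
have [x0 y0] : x = 0 /\ y = 0 by split; lra.
have uv1 : u ^+ 2 + v ^+ 2 = 1 by rewrite x0 y0 in h1; rewrite !expr2; lra.
pose z : C := sqrtC (u +i* v).
have z2 : z * z = u +i* v by rewrite -expr2 sqrtCK.
have zz : z * z^*%C = 1.
  have : (z * z^*%C) ^+ 2 == 1.
    rewrite exprMn -rmorphXn /= expr2 z2.
    by apply/eqP; apply/eqP; rewrite eq_complex /= -uv1; apply/andP; split; apply/eqP; ring.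
  rewrite sqrf_eq1 => /orP[/eqP //|/eqP h].
  have : 0 <= z * z^*%C by exact: mulcJ_ge0.
  by rewrite h oppr_ge0 ler10.
have sD : SL2 (mx2 z 0 0 z^*%C) by rewrite /SL2 /= det_mx2 mulr0 subr0.
have D0 : phi (mx2 z 0 0 z^*%C) (hermc 1 1 0 0) = hermc 1 1 0 0.
  apply: phi_hermx; rewrite ?conjc0 ?rmorph1 ?conjcK !(mulr1, mul0r, mulr0, addr0, add0r) //.
  by rewrite mulrC.
have D3 : phi (mx2 z 0 0 z^*%C) (hermc 1 (-1) 0 0) = hermc 1 (-1) 0 0.
  apply: phi_hermx; rewrite ?conjc0 ?rmorphN ?rmorph1 ?conjcK
    !(mulr1, mul0r, mulr0, addr0, add0r) //.
  by rewrite mulrN1 mulNr mulrC zz.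
have D1 : phi (mx2 z 0 0 z^*%C) (hermc 0 0 1 0) = hermc 0 0 u v.
  apply: phi_hermx; rewrite ?conjc0 ?rmorph0 ?conjcK -[1 +i* 0]/(1 : C) ?conjc1
    !(mulr1, mul0r, mulr0, addr0, add0r) //.
have phiV M H G : SL2 M -> phi M H = G -> phi (invmx M) G = H.
  by move=> sM <-; rewrite phiVK.
apply: (phi_image_comp sD); apply: SO_fix3.
- by apply: SO_comp_phi => //; exact: SL2V.
- by rewrite comp_lfunE f0; exact: phiV.
- by rewrite comp_lfunE f3; exact: phiV.
- by rewrite comp_lfunE f1 x0 y0; exact: phiV.
Qed.

(** The image of sigma_3 is a point of the unit sphere of traceless hermitian matrices, and an
    explicit element of [SU(2)] moves sigma_3 there. *)
Lemma SO_fix1 f : SO_herm f -> f (hermc 1 1 0 0) = hermc 1 1 0 0 -> phi_image f.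
Proof.
move=> SOf f0; have [fq _] := SOf.
have [x [y [u [v f3]]]] := hermc_eta (f (hermc 1 (-1) 0 0)).
have h0 := polar_preserved fq f3 f0; have h3 := polar_preserved fq f3 f3.
have yE : y = - x by lra.
have xuv : x ^+ 2 + u ^+ 2 + v ^+ 2 = 1 by rewrite yE in h3; rewrite !expr2; lra.
pose z : C := u +i* v.
have zz : z * z^*%C = (1 - x ^+ 2)%:C.
  by apply/eqP; rewrite eq_complex /= -xuv; apply/andP; split; apply/eqP; ring.
have [al [be [ab1 abx abz]]] : exists (al : R) (be : C),
    [/\ al%:C * al%:C + be * be^*%C = 1, al%:C * al%:C - be * be^*%C = x%:C
      & al%:C * be + al%:C * be = z].
  (* The general solution [al = sqrt((1 + x) / 2)], [be = z / (2 * al)] degenerates at the antipode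
     [- sigma_3], which is treated apart. *)
  have [xm1|xm1] := eqVneq x (- 1).
    exists 0, 1; rewrite conjc1 !mulr0 !mul0r !mulr1 add0r sub0r; split=> //.
      by rewrite xm1 rmorphN rmorph1.
    have u0 : u = 0 by rewrite xm1 in xuv; nra.
    have v0 : v = 0 by rewrite xm1 in xuv; nra.
    by rewrite addr0 /z u0 v0.
  have x1 : 0 < 1 + x.
    have : - 1 <= x by nra.
    by rewrite le_eqVlt eq_sym (negPf xm1) /=; lra.
  pose t := Num.sqrt (2 * (1 + x)).
  have t2 : t * t = 2 * (1 + x) by rewrite -expr2 sqr_sqrtr //; lra.
  have t0 : t != 0 by apply: contra_eq_neq t2 => ->; rewrite mul0r; apply/eqP; lra.
  have tC0 : t%:C != 0 by rewrite -[0]/(0%:C) (inj_eq (@complexI R)).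
  have bb : z / t%:C * (z / t%:C)^*%C = ((1 - x ^+ 2) / (t * t))%:C.
    rewrite rmorphM fmorphV /= real_subi0 mulrACA zz -invfM -!rmorphM -fmorphV.
    by rewrite -rmorphM.
  exists ((1 + x) / t), (z / t%:C); rewrite bb -!rmorphM -!rmorphD -!rmorphB /=.
  have aa : (1 + x) / t * ((1 + x) / t) = (1 + x) ^+ 2 / (t * t) by field.
  have x10 : 1 + x != 0 by exact: lt0r_neq0.
  split.
  - by rewrite aa t2 -(rmorph1 (real_complex R)); congr (_%:C); field.
  - by rewrite aa t2; congr (_%:C); field.
  - have xE : 1 + x = t * t / 2 by rewrite t2; field.
    have -> : ((1 + x) / t)%:C = (t / 2)%:C by congr (_%:C); rewrite xE; field.
    rewrite rmorphM fmorphV /= rmorph_nat; field.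
    exact: tC0.
have sU : SL2 (mx2 al%:C (- be) be^*%C al%:C).
  by rewrite /SL2 /= det_mx2 mulNr opprK.
have U0 : phi (mx2 al%:C (- be) be^*%C al%:C) (hermc 1 1 0 0) = hermc 1 1 0 0.
  apply: phi_hermx; rewrite ?conjc0 ?rmorph1 ?rmorphN /= ?conjcK ?real_subi0
    !(mulr1, mul0r, mulr0, addr0, add0r).
  - by rewrite mulrNN.
  - by rewrite mulNr mulrC subrr.
  - by rewrite addrC mulrC [_^*%C * _]mulrC.
have U3 : phi (mx2 al%:C (- be) be^*%C al%:C) (hermc 1 (-1) 0 0) = hermc x y u v.
  rewrite yE; apply: phi_hermx; rewrite ?conjc0 ?rmorph1 ?rmorphN /= ?rmorph1 ?conjcK ?real_subi0
    !(mulr1, mul0r, mulr0, addr0, add0r, mulrN1, opprK).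
  - by rewrite mulrN.
  - by rewrite [be * _]mulrC.
  - by rewrite mulNr -abx opprB [_^*%C * _]mulrC.
apply: (phi_image_comp sU); apply: SO_fix2.
- by apply: SO_comp_phi => //; exact: SL2V.
- by rewrite comp_lfunE f0 -{1}U0 phiVK.
- by rewrite comp_lfunE f3 -{1}U3 phiVK.
Qed.

(** The image of the identity matrix is positive definite of determinant 1, so it is [A A^*] for a
    lower triangular [A] of determinant 1 (Cholesky). Composing with the inverse of [phi A] leaves
    an isometry fixing the identity matrix. *)
Lemma phi_surjective f : SO0_herm f -> phi_image f.
Proof.
move=> [SOf trf]; have [fq _] := SOf.
have [p [s [u [v f0]]]] := hermc_eta (f (herm1 R)).
have q1 : p * s - u ^+ 2 - v ^+ 2 = 1.
  by rewrite -hermc_q -f0 fq herm1E hermc_q; ring.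
have ps : 0 < p + s.
  move: trf; rewrite f0 /mxtrace sum_ord2 hermcE !mxE /= -rmorphD /=.
  by rewrite -[0]/(0%:C) ltcR.
have p0 : 0 < p by nra.
have [z zE] : exists z : C, z = u +i* v by exists (u +i* v).
have zz : z * z^*%C = (p * s - 1)%:C.
  by apply/eqP; rewrite zE eq_complex /=; apply/andP; split; apply/eqP; lra.
pose r := Num.sqrt p; have r2 : r * r = p by rewrite -expr2 sqr_sqrtr // ltW.
have r0 : r != 0 by apply: contra_eq_neq r2 => ->; rewrite mul0r eq_sym lt0r_neq0.
have rC0 : r%:C != 0 by rewrite -[0]/(0%:C) (inj_eq (@complexI R)).
pose A : 'M[C]_2 := mx2 r%:C 0 (z^*%C / r%:C) (r%:C)^-1.
have sA : SL2 A by rewrite /SL2 /= det_mx2 mul0r subr0 mulfV.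
have A0 : phi A (hermc 1 1 0 0) = hermc p s u v.
  rewrite [RHS]/hermc -zE; apply: phi_hermx;
    rewrite ?conjc0 ?rmorph1 ?(rmorphM, fmorphV) /= ?conjcK ?real_subi0
    !(mulr1, mul0r, mulr0, addr0, add0r).
  - by rewrite -rmorphM /= r2.
  - by rewrite mulrCA mulfV ?mulr1.
  - rewrite mulrACA [z^*%C * _]mulrC zz -invfM -[X in _ + X]mul1r -mulrDl -rmorphM r2.
    rewrite -(rmorph1 (real_complex R)) -rmorphD -fmorphV -rmorphM; congr (_%:C).
    by field; exact: lt0r_neq0.
apply: (phi_image_comp sA); apply: SO_fix1.
  by apply: SO_comp_phi => //; exact: SL2V.
by rewrite comp_lfunE -herm1E f0 -{1}A0 phiVK // herm1E.
Qed.

End Surjectivity.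


(** 0 is not squarefree in this sense, because the square of 0 divides 0. *)
Lemma squarefree_gt0 (m : nat) : squarefree m -> (0 < m)%N.
Proof. by case: m => // /(_ 0%N) h; have := h isT. Qed.

Unset Implicit Arguments.

Theorem theorem2 (R : realType) (m : nat) (GammaStar : set 'M[R[i]]_2) :
  squarefree m ->
  maximal_discrete_extension (GammaK m) GammaStar ->
  @phi R @` GammaStar = SigmaStar m.
Proof.
move=> /squarefree_gt0 m_gt0 /(maximal_discrete_extension_stabilizer m_gt0) ->.
apply/seteqP; split=> [_ [M /lattice_stabilizerP[sM hM] <-]|f [SOf fL]].
  by split=> //; exact: phi_SO0.
have [M sM fE] := phi_surjective SOf; exists M => //.
by apply/lattice_stabilizerP; split=> //; rewrite -fE.
Qed.
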